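(* For every $\Delta\in\mathbb N$ and $\alpha>0$ there exists a positive constant $C$ such that the following holds for every sufficiently large $d\in\mathbb N$. If $G$ is an $(n,d,\lambda)$-graph with $d/\lambda\ge C$, then $G$ contains a copy of every $n$-vertex tree with maximum degree at most $\Delta$ and at least $\alpha n$ leaves.
   Context: An $(n,d,\lambda)$-graph is an $n$-vertex $d$-regular graph such that every eigenvalue of its adjacency matrix other than the largest one (which equals $d$) has absolute value at most $\lambda$. ''Sufficiently large $d$'' means: there exists $d_0=d_0(\Delta,\alpha)$ such that the statement holds for all $d\ge d_0$ (with $C$ fixed). *)

(* Defs.v *)
From HB Require Import structures.
From mathcomp Require Import all_boot all_order all_algebra.
From mathcomp Require Import reals.

Set Implicit Arguments.
Unset Strict Implicit.
Unset Printing Implicit Defensive.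

Import Order.TTheory GRing.Theory Num.Theory.

Local Open Scope ring_scope.

Record sgraph := SGraph {
  vertex :> finType;
  edge : rel vertex;
  edge_sym : symmetric edge;
  edge_irrefl : irreflexive edge
}.

Definition degree (G : sgraph) (v : G) : nat := #|[set w : G | edge v w]|.

Definition max_degree (G : sgraph) : nat := (\max_(v : G) degree v)%N.

Definition regular (d : nat) (G : sgraph) : Prop :=
  forall v : G, degree v = d.

Definition leaves (G : sgraph) : {set G} := [set v : G | degree v == 1%N].

Definition connected_graph (G : sgraph) : Prop :=
  (0 < #|G|)%N /\ forall x y : G, connect (@edge G) x y.

(* [ucycle] holds of [:: x; y] for every edge xy (and of [::]), hence the
   size bound. *)
Definition acyclic (G : sgraph) : Prop :=
  forall c : seq G, ucycle (@edge G) c -> (size c <= 2)%N.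

Definition is_tree (G : sgraph) : Prop := connected_graph G /\ acyclic G.

(* Copies are subgraphs, not necessarily induced. *)
Definition contains_copy (G H : sgraph) : Prop :=
  exists f : H -> G,
    injective f /\ forall x y : H, edge x y -> edge (f x) (f y).

Definition adjacency (R : realType) (G : sgraph) : 'M[R]_#|G| :=
  \matrix_(i, j) (edge (enum_val i) (enum_val j))%:R.

(* [s] lists the eigenvalues of [A] in nonincreasing order, each repeated
   according to its algebraic multiplicity. *)
Definition is_spectrum (R : realType) (n : nat) (A : 'M[R]_n) (s : seq R)
    : Prop :=
  sorted >=%R s /\ char_poly A = \prod_(x <- s) ('X - x%:P).

(* Eigenvalues count with multiplicity: only one occurrence of the largest one
   is exempt from the bound, so a disconnected d-regular graph has d <= lambda.
   The spectrum exists for every G, since the adjacency matrix is symmetric. *)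
Definition ndlambda_graph (R : realType) (n d : nat) (lambda : R) (G : sgraph)
    : Prop :=
  [/\ #|G| = n,
      regular d G
    & exists s : seq R, is_spectrum (adjacency R G) s /\
        forall x : R, x \in behead s -> `|x| <= lambda].

(* Main.v *)
Require Import Defs.
From HB Require Import structures.
From mathcomp Require Import all_boot all_order all_algebra.
From mathcomp Require Import reals boolp zify ring lra.
From mathcomp Require Import sesquilinear spectral complex.

Set Implicit Arguments.
Unset Strict Implicit.
Unset Printing Implicit Defensive.

Import Order.TTheory GRing.Theory Num.Theory.

(** Let T' be the tree without its leaves and P the set of parents of leaves.
    T' is embedded by the Friedman-Pippenger method, adding one leaf at a time
    while every small vertex set keeps enough unused neighbours; the leaves are
    placed at the end by Hall's theorem.  For Hall's condition every vertex
    left over must see many images of P.  To this end the local lemma provides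
    a small set X into which all small sets expand, as they do into its
    complement, and T' is embedded so that X is covered by images of P.

    Covering X proceeds in phases.  Let m be such that any two sets of m
    vertices are joined by an edge, and let B be a large constant.  After phase
    k fewer than m / B^k vertices of X are uncovered.  When the embedding
    reaches a vertex a of T' lying 2k+1 levels above some p in P, one tries to
    reach an uncovered vertex of X from the image of a by a path of length 2k+1
    through unused vertices.  If that fails, the tree is continued arbitrarily.
    The images of the vertices a of failed attempts still expand, as does the
    uncovered part of X, so if both sets have size m / B^k they grow, within k
    steps each, into two sets of size m, which are joined by an edge; forgetting
    the later steps of the embedding, the path so found was available at the
    time of the failed attempt.  Hence there are few failures, and since balls
    in T' grow much more slowly than B^k, the phases together consume only a
    small part of the tree. *)

(** * Neighbourhoods of sets and joinedness *)

Section Neighbourhoods.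
Variables (V : finType).
Implicit Types (r : rel V) (A B : {set V}).

Definition nbhd r A : {set V} := [set y | [exists x in A, r x y]].

Lemma nbhdP r A y : reflect (exists2 x, x \in A & r x y) (y \in nbhd r A).
Proof.
rewrite inE; apply: (iffP existsP) => [[x /andP[]]|[x xA rxy]]; first by exists x.
by exists x; rewrite xA.
Qed.

Lemma nbhdU r A B : nbhd r (A :|: B) = nbhd r A :|: nbhd r B.
Proof.
apply/setP => y; rewrite in_setU; apply/nbhdP/orP.
  by case=> x; rewrite inE => /orP[] xA rxy; [left|right]; apply/nbhdP; exists x.
by case=> /nbhdP[x xA rxy]; exists x; rewrite // inE xA ?orbT.
Qed.

Lemma sub_nbhd r r' A B : A \subset B -> (forall x y, x \in A -> r x y -> r' x y) ->
  nbhd r A \subset nbhd r' B.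
Proof.
move=> /subsetP sAB srr; apply/subsetP => y /nbhdP[x xA rxy].
by apply/nbhdP; exists x; [apply: sAB|apply: srr].
Qed.

(** A neighbour of [A :&: B] is a neighbour of both sets. This submodularity makes tight sets closed
    under union in [claim_step]. *)
Lemma nbhd_submod r A B :
  #|nbhd r (A :|: B)| + #|nbhd r (A :&: B)| <= #|nbhd r A| + #|nbhd r B|.
Proof.
rewrite nbhdU -[X in _ <= X]cardsUI leq_add2l subset_leq_card // subsetI.
by rewrite !sub_nbhd ?subsetIl ?subsetIr.
Qed.

Definition joined (e : rel V) (m : nat) := forall A B,
  m <= #|A| -> m <= #|B| -> exists x y, [/\ x \in A, y \in B & e x y].

Lemma joined_nbhd e m A : joined e m -> m <= #|A| -> #|~: nbhd e A| < m.
Proof.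
move=> jG mA; rewrite ltnNge; apply/negP => /(jG _ _ mA)[x [y [xA]]].
by rewrite inE => /nbhdP nA exy; apply: nA; exists x.
Qed.

End Neighbourhoods.

(** * Claims and extendability *)

Section Claims.
Variables (V : finType) (e : rel V) (X : {set V}) (m D : nat).
Hypotheses (jG : joined e m) (m_gt0 : 0 < m).
Implicit Types (par : V -> option V) (A B : {set V}).

(* [par y = Some x] records that y was attached as a new leaf to x; a claimed
   vertex is thereafter available to its claimer only.  The vertices of X are
   never available. *)
Definition avail par : rel V :=
  fun x y => [&& e x y, y \notin X & (par y == None) || (par y == Some x)].

(** The Friedman-Pippenger condition. Degrees in the embedded tree need no correction term, because
    a vertex claimed from inside [A] still counts for [A]. Sizes go up to [2m] so as to cover the
    union of two sets of size at most [m]. *)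
Definition extendable par :=
  [forall A : {set V}, (#|A| <= m.*2) ==> (D * #|A| <= #|nbhd (avail par) A|)].

Definition claims par x := [set y | par y == Some x].
Definition claimed par := [set y | par y != None].
Definition add_claim par s y := fun v => if v == y then Some s else par v.
Definition par_le par par' := forall y, par y != None -> par' y = par y.

Lemma par_le_trans par1 par2 par3 :
  par_le par1 par2 -> par_le par2 par3 -> par_le par1 par3.
Proof. by move=> le12 le23 y ny; rewrite le23 ?le12. Qed.

Lemma par_le_add par s y : par y = None -> par_le par (add_claim par s y).
Proof. by move=> py v pv; rewrite /add_claim; case: (eqVneq v y) pv => [->|//]; rewrite py. Qed.

(* Rollback: forgetting claims only makes more vertices available. *)
Lemma extendable_le par par' : par_le par par' -> extendable par' -> extendable par.
Proof.
move=> le_par /forallP ext'; apply/forallP => A; apply/implyP => mA.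
apply: leq_trans (implyP (ext' A) mA) (subset_leq_card (sub_nbhd _ _)) => //.
move=> x y _; rewrite /avail => /and3P[-> ->] /=.
by have [//|py] := boolP (par y == None); rewrite (le_par _ py) (negbTE py).
Qed.

Lemma extendableP par A : extendable par -> #|A| <= m.*2 ->
  D * #|A| <= #|nbhd (avail par) A|.
Proof. by move/forallP/(_ A)/implyP. Qed.

(** If every candidate [y] fails, each failure yields a tight set that avoids [s] and has [y] among
    its available neighbours. Tight sets are closed under union, so a largest one [A] contains them
    all. Then [s] adds to the neighbours of [A] only its own claims, fewer than [D], against
    extendability at [s |: A]. *)
Lemma claim_step par s : extendable par -> #|claims par s| < D ->
  #|X :|: claimed par| + D.*2.+1 * m <= #|V| ->
  exists y, [/\ e s y, y \notin X, par y = None & extendable (add_claim par s y)].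
Proof.
move=> ext clD szV.
case: (boolP [exists y, [&& e s y, y \notin X, par y == None &
  extendable (add_claim par s y)]]).
  by case/existsP=> y /and4P[? ? /eqP ? ?]; exists y.
move/existsPn=> noy; exfalso; set N := nbhd (avail par).
pose tight A := [&& s \notin A, #|A| <= m.*2 & #|N A| <= D * #|A|].
(* A set of more than [m] vertices sees all but fewer than [m] vertices of the graph, so the size
   hypothesis gives it too many available neighbours to be tight. *)
have tight_small A : tight A -> #|A| <= m.
  case/and3P=> _ A2 NA; rewrite leqNgt; apply/negP => mA.
  have := joined_nbhd jG (ltnW mA).
  have : #|nbhd e A| <= #|N A| + #|X :|: claimed par|.
    apply: leq_trans (leq_card_setU _ _); apply/subset_leq_card/subsetP => y /nbhdP[x xA exy].
    rewrite !inE; case: (boolP (y \in X)) => yX; rewrite ?orbT //=.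
    case: eqP => py; rewrite ?orbT // orbF; apply/existsP; exists x.
    by rewrite xA /avail exy yX py.
  have := cardsC (nbhd e A); have : D * #|A| <= D * m.*2 by rewrite leq_mul2l A2 orbT.
  move: szV NA; rewrite mulSn -!muln2; lia.
have tightU A B : tight A -> tight B -> tight (A :|: B).
  move=> tA tB; have mA := tight_small _ tA; have mB := tight_small _ tB.
  have szU : #|A :|: B| <= m.*2.
    by apply: leq_trans (leq_card_setU _ _) _; rewrite -addnn leq_add.
  case/and3P: tA => sA _ NA; case/and3P: tB => sB _ NB.
  rewrite /tight szU inE negb_or sA sB /=.
  have := nbhd_submod (avail par) A B; rewrite -!/(N _).
  have szI : #|A :&: B| <= m.*2.
    by apply: leq_trans (subset_leq_card (subsetIl A B)) _; lia.
  have := extendableP ext szI; rewrite -/(N _).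
  have : D * #|A :|: B| + D * #|A :&: B| = D * #|A| + D * #|B|.
    by rewrite -!mulnDr cardsUI.
  lia.
have t0 : tight set0.
  rewrite /tight in_set0 cards0 muln0 leq0n /= leqn0 cards_eq0; apply/eqP/setP => y.
  by rewrite in_set0; apply/nbhdP => -[x]; rewrite inE.
case: (arg_maxnP (fun A : {set V} => #|A|) t0) => A tA maxA.
have subA B : tight B -> B \subset A.
  move=> tB; have /maxA/= : tight (A :|: B) by apply: tightU.
  move=> le; have /eqP -> : A == A :|: B by rewrite eqEcard subsetUl.
  exact: subsetUr.
(* The set [B] that violates extendability after [s] claims [y] cannot contain [s], to which [y]
   remains available. It loses no vertex but [y], so it was tight before. *)
have freeA y : e s y -> y \notin X -> par y = None -> y \in N A.
  move=> esy yX py; have := noy y; rewrite esy yX py /= => /forallPn[B].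
  rewrite negb_imply -ltnNge => /andP[B2].
  set N' := nbhd _ B => NB.
  have sub z : z \in N B -> z != y -> z \in N'.
    case/nbhdP=> x xB axz zy; apply/nbhdP; exists x => //.
    by rewrite /avail /add_claim (negbTE zy).
  have lb := extendableP ext B2; rewrite -/(N _) in lb.
  have sB : s \notin B.
    apply: contraL NB => sB; rewrite -leqNgt (leq_trans lb) //.
    apply/subset_leq_card/subsetP => z zN; case: (eqVneq z y) => [->|/sub->//].
    by apply/nbhdP; exists s; rewrite // /avail /add_claim esy yX eqxx /= eqxx.
  have yN : y \in N B.
    apply: contraLR NB => yN; rewrite -leqNgt (leq_trans lb) //.
    apply/subset_leq_card/subsetP => z zN; apply: sub => //.
    by apply: contraNneq yN => <-.
  have tB : tight B.
    have : #|N B :\ y| <= #|N'|.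
      by apply/subset_leq_card/subsetP => z /setD1P[zy zN]; apply: sub.
    by rewrite /tight B2 sB (cardsD1 y (N B)) yN /=; lia.
  by apply: subsetP yN; apply: sub_nbhd => //; apply: subA.
have [sA _ NA] := and3P tA; have mA := tight_small _ tA.
have szA : #|s |: A| <= m.*2 by rewrite cardsU1 sA -addnn; lia.
have := extendableP ext szA; rewrite -/(N _) cardsU1 sA mulnDr muln1.
have : #|N (s |: A)| <= #|N A| + #|claims par s|.
  apply: leq_trans (leq_card_setU _ _); apply/subset_leq_card/subsetP => y.
  rewrite /N nbhdU in_setU => /orP[/nbhdP[x /set1P-> /and3P[esy yX]]|yN]; last first.
    by rewrite in_setU yN.
  rewrite in_setU; case: eqP => [/freeA->|_ /= /eqP py] //.
  by rewrite [y \in claims _ _]inE py eqxx orbT.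
lia.
Qed.

(** By the last clause a vertex outside [X] that is still unclaimed has claimed nothing, so a newly
    claimed vertex starts with all its capacity. *)
Definition wf_claims par := forall x y, par y = Some x ->
  [/\ e x y, y \notin X & (x \in X) || (par x != None)].

(** A vertex is listed in [ss] as often as it is to receive a new child, hence the multiplicity in
    the bound on its claims. *)
Lemma claim_seq par ss : extendable par ->
    (forall s, s \in ss -> #|claims par s| + count_mem s ss <= D) ->
    #|X :|: claimed par| + size ss + D.*2.+1 * m <= #|V| ->
  exists par' (Z : {set V}), [/\ extendable par', par_le par par', #|Z| = size ss,
    forall y, y \in Z -> [/\ par y = None, y \notin X &
       exists2 x, x \in ss & par' y = Some x /\ e x y] &
    forall y, y \notin Z -> par' y = par y].
Proof.
elim: ss par => [|s ss IH] par ext cnt szV.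
  by exists par, set0; split; rewrite ?cards0 // => y; rewrite inE.
have [||y [esy yX py ext1]] := @claim_step par s ext.
- by have := cnt s (mem_head _ _); rewrite /= eqxx; lia.
- by move: szV; rewrite /=; lia.
set par1 := add_claim par s y in ext1 *.
have clm x : claims par1 x \subset (if x == s then y |: claims par x else claims par x).
  apply/subsetP => z; rewrite inE /par1 /add_claim; case: (eqVneq z y) => [->|zy].
    by move=> /eqP[->]; rewrite eqxx setU11.
  by move=> pz; case: ifP => _; rewrite !inE pz ?orbT.
have [|| par' [Z [ext' le1 cZ Zin Zout]]] := IH par1 ext1.
- move=> x xss; have := cnt x; rewrite inE xss orbT => /(_ isT) /=.
  have := subset_leq_card (clm x); rewrite [s == x]eq_sym; case: ifP => _ /=.
    by rewrite cardsU1; case: (_ \in _) => /=; lia.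
  by lia.
- have : #|X :|: claimed par1| <= #|y |: (X :|: claimed par)|.
    apply/subset_leq_card/subsetP => z; rewrite !inE /par1 /add_claim.
    by case: (eqVneq z y).
  by rewrite cardsU1; case: (_ \in _) => /=; move: szV => /=; lia.
have yZ : y \notin Z.
  by apply/negP => /Zin[]; rewrite /par1 /add_claim eqxx.
exists par', (y |: Z); split=> //.
- exact: par_le_trans (par_le_add s py) le1.
- by rewrite cardsU1 yZ cZ.
- move=> z /setU1P[->|/Zin[p1z zX [x xss [pz exz]]]].
    split=> //; exists s; first exact: mem_head.
    by rewrite Zout // /par1 /add_claim eqxx.
  split=> //; last by exists x; rewrite // inE xss orbT.
  by move: p1z; rewrite /par1 /add_claim; case: eqP.
- move=> z; rewrite !inE negb_or => /andP[zy /Zout->].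
  by rewrite /par1 /add_claim (negbTE zy).
Qed.

Definition free par := [pred v | (par v == None) && (v \notin X)].

Lemma chain_claimed par y c : path (fun a b => par b == Some a) y c ->
  all (fun v => par v != None) c.
Proof. by elim: c y => //= v c IH y /andP[/eqP-> /IH->]. Qed.

(** * Growing forests of claims and linking them *)

Section Growth.
Variables (B : nat).
Hypotheses (B_gt1 : 1 < B) (BD : B <= D).

(* Choosing the level sizes backwards from M makes them geometric, which keeps
   the total size of the forest below 2M + k. *)
Lemma grow k M par (Z : {set V}) : extendable par -> wf_claims par ->
    (forall z, z \in Z -> (z \in X) || (par z != None)) ->
    (forall z, z \in Z -> #|claims par z| + B <= D) ->
    M <= #|Z| * B ^ k ->
    #|X :|: claimed par| + (M.*2 + k) + D.*2.+1 * m <= #|V| ->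
  exists par' (Z' : {set V}), [/\ extendable par', wf_claims par', par_le par par', M <= #|Z'| &
     #|X :|: claimed par'| <= #|X :|: claimed par| + (M.*2 + k)] /\
   [/\ forall x y, par' y = Some x -> [\/ par y = Some x, x \in Z | free par x],
       forall z, z \in Z' -> (z \in X) || (par' z != None),
       forall z, z \in Z' -> #|claims par' z| + B <= D &
       forall z, z \in Z' -> exists y c, y \in Z /\
         [/\ size c = k, last y c = z, path (fun a b => par' b == Some a) y c,
             uniq c & all (free par) c]].
Proof.
elim: k M => [|k IH] M ext wf Zcl ZB MZ szV.
  exists par, Z; split; first by split; rewrite ?muln1 // in MZ *; lia.
  split=> // [x y pxy|z zZ]; first by constructor 1.
  by exists z, [::].
(* [M'] is [M / B] rounded up. As [B] is at least 2, the earlier levels cost at most [M.+1 + k] and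
   the new one costs [M], which together meet the budget [M.*2 + k.+1]. *)
pose M' := (M + B.-1) %/ B.
have M'B : M <= M' * B.
  by rewrite /M'; have := divn_eq (M + B.-1) B; have := ltn_pmod (M + B.-1) (ltnW B_gt1); lia.
have M'M : M'.*2 <= M.+1.
  have : M' * B <= M + B.-1 by apply: leq_trunc_div.
  by case: M' {M'B} => // M'' ; nia.
have M'Z : M' <= #|Z| * B ^ k.
  have : M' * B <= M + B.-1 by apply: leq_trunc_div.
  move: MZ; rewrite expnSr mulnA; move: (#|Z| * B ^ k) => q; nia.
have [|par1 [Z1 [[ext1 wf1 le1 cZ1 sz1] [dom1 Z1cl Z1B chain1]]]] :=
  IH M' ext wf Zcl ZB M'Z; first by lia.
(* Each vertex of the previous level asks for [B] children; the list is cut to exactly [M] entries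
   to stay within the budget. *)
pose ss := take M (flatten [seq nseq B z | z <- enum Z1]).
have ssZ x : x \in ss -> x \in Z1.
  move/mem_take/flattenP => [_ /mapP[z zZ ->]].
  by rewrite mem_nseq => /andP[_ /eqP->]; rewrite -mem_enum.
have sz_ss : size ss = M.
  rewrite size_takel // size_flatten /shape -map_comp (eq_map (g := fun=> B)).
    rewrite sumnE big_map big_const_seq count_predT iter_addn_0 -cardE.
    by apply: leq_trans M'B _; rewrite mulnC leq_mul2l cZ1 orbT.
  by move=> z; rewrite /= size_nseq.
have cnt_ss x : count_mem x ss <= B.
  have le_take : count_mem x ss <= count_mem x (flatten [seq nseq B z | z <- enum Z1]).
    by rewrite -[X in _ <= count_mem x X](cat_take_drop M) count_cat leq_addr.
  apply: leq_trans le_take _; rewrite count_flatten -map_comp sumnE big_map.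
  under eq_bigr => z _ do rewrite /= count_nseq /=.
  case: (boolP (x \in Z1)) => xZ; last first.
    rewrite big_seq big1 // => z; rewrite mem_enum => zZ.
    by case: eqP => // zx; rewrite -zx zZ in xZ.
  rewrite (bigD1_seq x) ?mem_enum ?enum_uniq //= eqxx mul1n big1 ?addn0 //.
  by move=> z /negbTE->.
have [||par2 [Z2 [ext2 le2 cZ2 Z2in Z2out]]] := @claim_seq par1 ss ext1.
- by move=> s /ssZ/Z1B; have := cnt_ss s; lia.
- by rewrite sz_ss; lia.
have cl2 : X :|: claimed par2 \subset Z2 :|: (X :|: claimed par1).
  apply/subsetP => z; rewrite !inE; case: (boolP (z \in Z2)) => //= /Z2out->.
  by [].
have wf2 : wf_claims par2.
  move=> x y; case: (boolP (y \in Z2)) => [/Z2in[p1y yX [x' /ssZ x'Z [-> exy]]] [<-]|yZ].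
    split=> //; case/orP: (Z1cl _ x'Z) => [->//|px]; apply/orP; right.
    by rewrite le2.
  rewrite Z2out // => /wf1[-> -> /orP[->|px]]; split=> //; apply/orP; right.
  by rewrite le2.
exists par2, Z2; split; [split=> //|split].
- exact: par_le_trans le1 le2.
- by rewrite cZ2 sz_ss.
- apply: leq_trans (subset_leq_card cl2) _; apply: leq_trans (leq_card_setU _ _) _.
  by rewrite cZ2 sz_ss; lia.
- move=> x y; case: (boolP (y \in Z2)) => [/Z2in[p1y yX [x' /ssZ x'Z [-> exy]]] [<-]|yZ].
    have [y' [c [y'Z [_ lst pth _ fre]]]] := chain1 _ x'Z.
    case: (lastP c) lst pth fre => [<- _ _|c' w]; first by constructor 2.
    by rewrite last_rcons all_rcons => -> _ /andP[fx _]; constructor 3.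
  by rewrite Z2out // => /dom1.
- by move=> z /Z2in[_ _ [x _ [-> _]]]; rewrite orbT.
- move=> z zZ; have [p1z zX _] := Z2in z zZ.
  suff -> : claims par2 z = set0 by rewrite cards0.
  apply/setP => y; rewrite !inE; apply/negP => /eqP.
  case: (boolP (y \in Z2)) => [/Z2in[_ _ [x /ssZ xZ [-> _]]] [xz]|yZ].
    by have := Z1cl _ xZ; rewrite xz p1z (negbTE zX).
  by rewrite Z2out // => /wf1[_ _]; rewrite p1z (negbTE zX).
- move=> z zZ; have [p1z zX [x /ssZ xZ [p2z exz]]] := Z2in z zZ.
  have [y [c [yZ [sc lst pth unq fre]]]] := chain1 _ xZ.
  exists y, (rcons c z); split=> //; split.
  + by rewrite size_rcons sc.
  + by rewrite last_rcons.
  + rewrite rcons_path lst p2z eqxx andbT.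
    by apply: sub_path pth => a b /eqP pb; rewrite le2 pb.
  + rewrite rcons_uniq unq andbT; apply/negP => /(allP (chain_claimed pth)).
    by rewrite p1z.
  + rewrite all_rcons fre andbT /= zX andbT; apply/eqP.
    case pz: (par z) => [w|//]; have := le1 z; rewrite pz p1z => /(_ isT).
    by [].
Qed.

(** [par2] is any extendable continuation in which each inner vertex of the path is claimed by a
    neighbour on the path. The claim may come from either side, since the two halves grow from
    opposite ends. Quantifying over [par2] makes the property insensitive to rollback. *)
Definition linkable par k y (U : {set V}) := exists par2 u z,
  [/\ u \in U, size z = k.*2, uniq z, all (free par) z & path e u (rcons z y)] /\
  [/\ par_le par par2, extendable par2 &
      forall v, v \in z -> exists x, par2 v = Some x /\
        (infix [:: x; v] (u :: rcons z y) \/ infix [:: v; x] (u :: rcons z y))].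

(** Used contrapositively: a failed attempt stays a failure as the embedding proceeds, since a
    vertex that is free later was free before and the target set only shrinks. *)
Lemma linkable_le par par' k y (U U' : {set V}) :
  par_le par par' -> U' \subset U -> linkable par' k y U' -> linkable par k y U.
Proof.
move=> le1 /subsetP sU [par2 [u [z [[uU sz unq fre pth] [le2 ext2 inf]]]]].
exists par2, u, z; split; split=> //; first exact: sU; last exact: par_le_trans le1 le2.
apply: sub_all fre => v /andP[/eqP pv vX]; rewrite /= vX andbT.
by apply/eqP; case pv1: (par v) => [w|//]; rewrite le1 ?pv1 in pv.
Qed.

Lemma chain_infix (r : rel V) y c v : path r y c -> v \in c ->
  exists x, r x v /\ infix [:: x; v] (y :: c).
Proof.
move=> pth /path.splitPr vc; case: vc pth => c1 c2.
rewrite cat_path => /and3P[_ rv _]; exists (last y c1); split=> //.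
apply/infixP; case/lastP: c1 rv => [|c1 w] _; first by exists [::], c2.
by exists (y :: c1), c2; rewrite last_rcons cat_rcons.
Qed.

(** Forests grown first from [Y] and then from [U] have at least [m] vertices each at level [k], so
    an edge joins these two levels. With the branches leading to its ends it forms a path of length
    [2k+1]; the branches are disjoint because the second forest only takes vertices left free by the
    first. *)
Lemma linkable_ex par k (Y U : {set V}) : symmetric e -> extendable par -> wf_claims par ->
    (forall y, y \in Y -> (y \in X) || (par y != None)) ->
    (forall y, y \in Y -> #|claims par y| + B <= D) ->
    U \subset X -> (forall u, u \in U -> claims par u = set0) -> [disjoint Y & U] ->
    m <= #|Y| * B ^ k -> m <= #|U| * B ^ k ->
    #|X :|: claimed par| + (m.*2 + k).*2 + D.*2.+1 * m <= #|V| ->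
  exists2 y, y \in Y & linkable par k y U.
Proof.
move=> sym_e ext wf Ycl YB UX Ucl dYU mY mU szV.
have [|par1 [Y1 [[ext1 wf1 le1 mY1 sz1] [dom1 _ _ chain1]]]] := grow ext wf Ycl YB mY.
  by lia.
have U1cl u : u \in U -> claims par1 u = set0.
  move=> uU; apply/setP => y; rewrite !inE; apply/negP => /eqP/dom1[pyu|uY|].
  - by have := Ucl u uU => /setP/(_ y); rewrite !inE pyu eqxx.
  - by rewrite (disjointFr dYU uY) in uU.
  - by rewrite /= (subsetP UX) // andbF.
have [||||par2 [U2 [[ext2 wf2 le2 mU2 _] [_ _ _ chain2]]]] := @grow k m par1 U ext1 wf1.
- by move=> u uU; rewrite (subsetP UX).
- by move=> u uU; rewrite U1cl // cards0.
- by [].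
- by lia.
have [z1 [w1 [z1Y w1U ezw]]] := jG mY1 mU2.
have [y [c1 [yY [sc1 lst1 pth1 unq1 fre1]]]] := chain1 _ z1Y.
have [u [c2 [uU [sc2 lst2 pth2 unq2 fre2]]]] := chain2 _ w1U.
have pth1' : path (fun a b => par2 b == Some a) y c1.
  by apply: sub_path pth1 => a b /eqP pb; rewrite le2 pb.
have edge2 a b : par2 b == Some a -> e a b by move=> /eqP/wf2[].
exists y => //; exists par2, u, (c2 ++ rev c1).
have defs : u :: rcons (c2 ++ rev c1) y = (u :: c2) ++ rev (y :: c1).
  by rewrite rev_cons rcons_cat.
split; split=> //.
- by rewrite size_cat size_rev sc1 sc2 addnn.
- rewrite cat_uniq rev_uniq unq1 unq2 andbT /=; apply/hasPn => v.
  rewrite mem_rev => vc1; apply/negP => /(allP fre2)/= /andP[/eqP p1v _].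
  by have := allP (chain_claimed pth1) _ vc1; rewrite p1v.
- rewrite all_cat all_rev fre1 andbT; apply: sub_all fre2 => v /andP[/eqP pv vX].
  rewrite /= vX andbT; apply/eqP; case pv1: (par v) => [w|//].
  by have := le1 v; rewrite pv1 pv => /(_ isT).
- rewrite rcons_cat cat_path (sub_path edge2 pth2) lst2 /= -rev_cons.
  have -> : rev (y :: c1) = z1 :: rev (belast y c1).
    by rewrite lastI rev_rcons lst1.
  rewrite /= sym_e ezw /= -lst1 rev_path.
  by apply: sub_path pth1' => a b /edge2; rewrite sym_e.
- exact: par_le_trans le1 le2.
- move=> v; rewrite mem_cat mem_rev => /orP[vc|vc].
    have [x [/eqP pvx inf]] := chain_infix pth2 vc; exists x; split=> //; left.
    by rewrite defs infix_catr.
  have [x [/eqP pvx inf]] := chain_infix pth1' vc; exists x; split=> //; right.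
  by rewrite defs infix_catl // -[[:: v; x]]/(rev [:: x; v]) infix_rev.
Qed.
End Growth.
End Claims.

Lemma leq_card_bigcup (I T : finType) (Q : pred I) (F : I -> {set T}) :
  #|\bigcup_(i | Q i) F i| <= \sum_(i | Q i) #|F i|.
Proof.
elim/big_rec2: _ => [|i n U _ leUn]; first by rewrite cards0.
by rewrite (leq_trans (leq_card_setU _ _)) ?leq_add2l.
Qed.

(** * Rooted trees *)

Section RootedTree.
Variables (T : finType) (r : T) (pa : T -> T) (dep : T -> nat) (delta : nat).
Hypothesis pa_r : pa r = r.
Hypothesis dep_r : dep r = 0.
Hypothesis dep_pa : forall t, t != r -> dep t = (dep (pa t)).+1.
Hypothesis card_pa : forall w, #|[set t | pa t == w]| <= delta.

Definition anc t : {set T} := [set s | [exists i : 'I_(dep t).+1, iter i pa t == s]].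
Definition desc v : {set T} := [set t | v \in anc t].

Lemma in_desc v t : (t \in desc v) = (v \in anc t).
Proof. by rewrite inE. Qed.

Lemma ancP t s : reflect (exists2 i, i <= dep t & iter i pa t = s) (s \in anc t).
Proof.
rewrite inE; apply: (iffP existsP) => [[i /eqP<-]|[i le_i <-]].
  by exists i; rewrite // -ltnS ltn_ord.
by exists (Ordinal (n := (dep t).+1) (m := i) le_i).
Qed.

Lemma dep_iter i t : iter i pa t != r -> dep t = i + dep (iter i pa t).
Proof.
elim: i => //= i IH ni; have nr : iter i pa t != r.
  by apply: contraNneq ni => ->; rewrite pa_r.
by rewrite IH // dep_pa // addSnnS.
Qed.

Lemma dep_iterB i t : i <= dep t -> dep (iter i pa t) = dep t - i.
Proof.
elim: i => [|i IH] le_i; first by rewrite subn0.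
have dep_i := IH (ltnW le_i).
have nr : iter i pa t != r by apply: contraTneq le_i => tr; rewrite tr dep_r in dep_i; lia.
by have := dep_pa nr; rewrite dep_i /=; lia.
Qed.

Lemma anc_refl t : t \in anc t.
Proof. by apply/ancP; exists 0. Qed.

Lemma anc_pa t : t != r -> anc t = t |: anc (pa t).
Proof.
move=> nr; apply/setP => s; rewrite in_setU1; apply/ancP/orP.
  case=> [[|i]] le_i <-; first by left.
  right; apply/ancP; exists i; last by rewrite iterSr.
  by rewrite dep_pa in le_i.
case=> [/eqP->|/ancP[i le_i <-]]; first by exists 0.
by exists i.+1; rewrite ?iterSr // dep_pa.
Qed.

Lemma anc_r : anc r = [set r].
Proof.
apply/setP => s; rewrite inE; apply/ancP/eqP => [[j]|->]; last by exists 0.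
by rewrite dep_r leqn0 => /eqP->.
Qed.

Lemma anc_iter i t : i <= dep t -> iter i pa t \in anc t.
Proof. by move=> le_i; apply/ancP; exists i. Qed.

Lemma anc_trans s t v : s \in anc t -> v \in anc s -> v \in anc t.
Proof.
case/ancP=> i le_i <- /ancP[j le_j <-]; rewrite -iterD.
by apply: anc_iter; rewrite dep_iterB // in le_j; lia.
Qed.

Lemma anc_dep s t : s \in anc t -> dep s <= dep t.
Proof. by case/ancP=> i le_i <-; rewrite dep_iterB ?leq_subr. Qed.

Lemma card_iter_pa i w : #|[set t | iter i pa t == w]| <= delta ^ i.
Proof.
elim: i w => [|i IH] w.
  by rewrite (_ : [set t | _] = [set w]) ?cards1 //; apply/setP => t; rewrite !inE.
have -> : [set t | iter i.+1 pa t == w] =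
    \bigcup_(s in [set s | pa s == w]) [set t | iter i pa t == s].
  apply/setP => t; rewrite inE; apply/idP/bigcupP => [pt|[s]].
    by exists (iter i pa t); rewrite inE.
  by rewrite !inE => ps /eqP it; rewrite /= it.
apply: leq_trans (leq_card_bigcup _ _) _.
apply: leq_trans (leq_sum _ (fun s _ => IH s)) _.
by rewrite sum_nat_const expnS leq_mul2r card_pa orbT.
Qed.

Lemma iter_closed (S : {set T}) i t :
  (forall t, t \in S -> pa t \in S) -> t \in S -> iter i pa t \in S.
Proof. by move=> clS tS; elim: i => //= i; apply: clS. Qed.

Lemma anc_closed (S : {set T}) t :
  (forall t, t \in S -> pa t \in S) -> t \in S -> anc t \subset S.
Proof. by move=> clS tS; apply/subsetP => s /ancP[i _ <-]; apply: iter_closed. Qed.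

(** Let [x] be a deepest descendant of [v] with more than half of the weight [w] below it, and [v']
    its heaviest child. By the choice of [x] at most half of [w] lies below [v']. The children of
    [x], at most [delta] in number, together carry at least [w / 4]. *)
Lemma desc_split (P : {set T}) v : 1 < #|P :&: desc v| ->
  exists v', [/\ desc v' \subset desc v, #|P :&: desc v| <= 4 * delta * #|P :&: desc v'| &
    #|P :&: desc v| <= 2 * #|P :&: (desc v :\: desc v')|].
Proof.
set w := #|_| => w_gt1.
pose heavy x := (x \in desc v) && (w < 2 * #|P :&: desc x|).
have hv : heavy v by rewrite /heavy in_desc anc_refl -/w; lia.
case: (arg_maxnP dep hv) => x /andP[xv hx] max_x.
pose ch := [set c | (pa c == x) && (c != r)].
have descE : desc x \subset x |: \bigcup_(c in ch) desc c.
  apply/subsetP => t; rewrite in_desc => /ancP[[|i] le_i itx].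
    by rewrite -itx setU11.
  rewrite inE; apply/orP; right; apply/bigcupP; exists (iter i pa t); last first.
    by rewrite in_desc anc_iter // ltnW.
  rewrite inE -itx eqxx /=; apply/eqP => ir.
  by have := dep_iterB (ltnW le_i); rewrite ir dep_r; lia.
have card_ch : #|ch| <= delta.
  apply: leq_trans (card_pa x); apply/subset_leq_card/subsetP => c.
  by rewrite !inE => /andP[].
have bound : #|P :&: desc x| <= 1 + \sum_(c in ch) #|P :&: desc c|.
  have sub : P :&: desc x \subset x |: \bigcup_(c in ch) (P :&: desc c).
    apply/subsetP => t /setIP[tP /(subsetP descE)]; rewrite !inE => /orP[->//|].
    case/bigcupP=> c cch tc; apply/orP; right; apply/bigcupP; exists c => //.
    by rewrite inE tP.
  apply: leq_trans (subset_leq_card sub) _; apply: leq_trans (leq_card_setU _ _) _.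
  by rewrite cards1 leq_add2l leq_card_bigcup.
case: (set_0Vmem ch) => [ch0|[c0 c0ch]].
  by move: bound; rewrite ch0 big_set0; lia.
case: (arg_maxnP (fun c => #|P :&: desc c|) c0ch) => c cch max_c.
have [/eqP pc c_nr] : pa c == x /\ c != r by have : c \in ch := cch; rewrite inE => /andP.
have xc : x \in anc c by rewrite anc_pa // pc setU1r // anc_refl.
have scv : desc c \subset desc v.
  apply/subsetP => t; rewrite !in_desc => ct.
  by apply: anc_trans ct (anc_trans xc _); rewrite -in_desc.
exists c; split=> //.
  have : \sum_(c in ch) #|P :&: desc c| <= delta * #|P :&: desc c|.
    apply: leq_trans (leq_sum _ max_c) _; rewrite sum_nat_const.
    by rewrite leq_mul2r card_ch orbT.
  by move: bound; rewrite -mulnA; lia.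
have : ~~ heavy c.
  apply/negP => /max_x; rewrite /= dep_pa // pc; lia.
rewrite /heavy (subsetP scv) ?in_desc ?anc_refl //= -leqNgt.
have : w <= #|P :&: desc c| + #|P :&: (desc v :\: desc c)|.
  apply: leq_trans (leq_card_setU _ _); apply/subset_leq_card/subsetP => t.
  by rewrite !in_setU !in_setI in_setD => /andP[-> ->]; case: (_ \in _).
lia.
Qed.

(** These vertices of [P] are too close to [v] for a path of length [i] going up strictly below [v]:
    they lie at most [i] levels under [v], and level [j] has at most [delta ^ j] vertices. *)
Lemma card_shallow (P : {set T}) v i :
  #|[set t in P :&: desc v | iter i pa t \notin desc v :\ v]| <= i.+1 * delta ^ i.
Proof.
have sub : [set t in P :&: desc v | iter i pa t \notin desc v :\ v] \subset
    \bigcup_(j < i.+1) [set t | iter j pa t == v].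
  apply/subsetP => t; rewrite !inE negb_and negbK => /andP[/andP[_]].
  case/existsP=> -[j /= lt_j] /eqP jv nv; apply/bigcupP.
  have [le_ji|lt_ij] := leqP j i; first by exists (Ordinal (n := i.+1) le_ji); rewrite ?inE //= jv.
  exists ord_max => //=; rewrite inE /=; case/orP: nv => [//|/negP[]].
  apply/existsP; have lt_jB : j - i < (dep (iter i pa t)).+1 by rewrite dep_iterB; lia.
  by exists (Ordinal lt_jB); rewrite /= -iterD subnK ?jv // ltnW.
apply: leq_trans (subset_leq_card sub) _.
apply: leq_trans (leq_card_bigcup _ _) _.
have d1 : 0 < delta.
  by apply: leq_trans (card_pa r); apply/card_gt0P; exists r; rewrite inE pa_r.
apply: leq_trans (leq_sum _ (E2 := fun=> delta ^ i) _) _ => [j _|].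
  by apply: leq_trans (card_iter_pa j v) _; rewrite leq_pexp2l // -ltnS.
by rewrite sum_nat_const card_ord.
Qed.

End RootedTree.

(** * Hall's theorem *)

Section Hall.
Variables (A B : finType) (b0 : B) (L : {set A}) (R : A -> B -> bool).

(* A minimal subsystem satisfying Hall's condition consists of singletons. *)
Lemma hall : (forall S : {set A}, S \subset L -> #|S| <= #|[set b | [exists a in S, R a b]]|) ->
  exists2 g : A -> B, {in L &, injective g} & forall a, a \in L -> R a (g a).
Proof.
move=> hallR.
pose N (F : {ffun A -> {set B}}) (S : {set A}) := \bigcup_(a in S) F a.
pose ok (F : {ffun A -> {set B}}) := [forall a, F a \subset [set b | R a b]] &&
  [forall S : {set A}, (S \subset L) ==> (#|S| <= #|N F S|)].
have ok0 : ok [ffun a => [set b | R a b]].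
  apply/andP; split; first by apply/forallP => a; rewrite ffunE.
  apply/forallP => S; apply/implyP => /hallR/leq_trans; apply.
  apply/subset_leq_card/subsetP => b; rewrite inE => /existsP[a /andP[aS Rab]].
  by apply/bigcupP; exists a; rewrite // ffunE inE.
case: (arg_minnP (fun F : {ffun A -> {set B}} => \sum_a #|F a|) ok0) => F okF minF.
have [/forallP subF /forallP hF] := andP okF.
have hallF (S : {set A}) : S \subset L -> #|S| <= #|N F S| by apply: implyP.
(* By minimality of [F], deleting [x] from [F a] breaks Hall's condition at some set, which must
   contain [a]; the set [S] is what remains of it without [a]. *)
have tightF a x : a \in L -> x \in F a -> exists S : {set A},
    [/\ S \subset L, a \notin S & #|N F S :|: F a :\ x| <= #|S|].
  move=> aL xF; pose F' := [ffun c => if c == a then F a :\ x else F c].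
  have F'sub c : F' c \subset F c by rewrite ffunE; case: eqP => // ->; apply: subD1set.
  have : ~~ ok F'.
    apply/negP => /minF; apply/negP; rewrite -ltnNge.
    rewrite (bigD1 a) //= [X in _ < X](bigD1 a) //= ffunE eqxx (cardsD1 x (F a)) xF.
    by rewrite addSn ltnS leq_add2l leq_sum // => c _; apply: subset_leq_card.
  rewrite negb_and => /orP[/forallPn[c]|/forallPn[S]].
    by rewrite (subset_trans (F'sub c)).
  rewrite negb_imply -ltnNge => /andP[SL ltS].
  have NF' (S0 : {set A}) : a \notin S0 -> N F' S0 = N F S0.
    move=> aS; apply: eq_bigr => c cS; rewrite ffunE; case: eqP => // ca.
    by rewrite -ca cS in aS.
  have aS : a \in S.
    by apply: contraTT ltS => /NF'->; rewrite -leqNgt hallF.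
  exists (S :\ a); split; [by apply: subset_trans SL; apply: subD1set|by rewrite setD11|].
  rewrite (cardsD1 a S) aS add1n ltnS in ltS; apply: leq_trans ltS.
  rewrite -(NF' (S :\ a)) ?setD11 // setUC /N.
  by rewrite [X in _ <= #|pred_of_set X|](big_setD1 a) //= ffunE eqxx.
(* Rado's argument: for two elements [x], [y] of [F a] with sets [S1], [S2], Hall's condition for
   [a |: (S1 :|: S2)] and for [S1 :&: S2] adds up to one more than the two tight bounds allow. *)
have cardF a : a \in L -> #|F a| = 1.
  move=> aL; apply/eqP; rewrite eqn_leq; apply/andP; split; last first.
    by have := hallF [set a]; rewrite /N big_set1 cards1 sub1set; apply.
  rewrite leqNgt; apply/negP => /card_gt1P[x [y [xF yF xy]]].
  have [S1 [S1L aS1 le1]] := tightF a x aL xF.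
  have [S2 [S2L aS2 le2]] := tightF a y aL yF.
  have : #|a |: (S1 :|: S2)| <= #|(N F S1 :|: F a :\ x) :|: (N F S2 :|: F a :\ y)|.
    apply: leq_trans (hallF _ _) _; first by rewrite !subUset sub1set aL S1L.
    apply/subset_leq_card/subsetP => b /bigcupP[c].
    rewrite !in_setU in_set1 => /orP[/eqP->|/orP[cS|cS]] bF.
    - rewrite !in_setD1 bF !andbT; case: (eqVneq b x) => [->|_]; last by rewrite orbT.
      by rewrite xy !orbT.
    - by apply/orP; left; apply/orP; left; apply/bigcupP; exists c.
    - by apply/orP; right; apply/orP; left; apply/bigcupP; exists c.
  have : #|S1 :&: S2| <= #|(N F S1 :|: F a :\ x) :&: (N F S2 :|: F a :\ y)|.
    apply: leq_trans (hallF _ _) _; first by apply: subset_trans S1L; apply: subsetIl.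
    apply/subset_leq_card/subsetP => b /bigcupP[c /setIP[c1 c2] bF].
    rewrite in_setI !in_setU; apply/andP.
    by split; apply/orP; left; apply/bigcupP; exists c.
  rewrite cardsU1 in_setU negb_or aS1 aS2 /= => leI leU.
  have := leq_add leU leI; rewrite [X in _ <= X]cardsUI -addnA cardsUI add1n.
  by rewrite leqNgt ltnS leq_add.
(* [b0] is returned only where [F a] is empty, which does not happen on [L]. *)
pose g a := odflt b0 [pick b in F a].
have gF a : a \in L -> F a = [set g a].
  move=> /cardF/eqP/cards1P[b Fb]; rewrite Fb /g.
  by case: pickP => [c|/(_ b)]; rewrite Fb inE ?eqxx // => /eqP->.
exists g => [a a' aL a'L gg|a aL]; last first.
  by have := subsetP (subF a) (g a); rewrite gF // inE eqxx inE; apply.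
apply: contraTeq isT => aa'; have := hallF [set a; a'].
rewrite subUset !sub1set aL a'L => /(_ isT).
by rewrite cards2 aa' /N bigcup_setU !big_set1 !gF // gg setUid cards1.
Qed.
End Hall.

(** * Embedding the inner tree *)

(** Here [u] counts the uncovered vertices, [q] is the target of the phase, [w] is the part of [P]
    at hand, and [i.+1.*2.+2 * d ^ i.+1.*2.+1] is the cost of one iteration. The factor 2 pays for
    [desc_split] and the extra iteration for [card_shallow]. After multiplication by [(4d)^i B^i]
    the left side is at most [32 d^3 M (8 d^3)^i], where [8 d^3 = 2 d^2 * 4 d], and [p B^i]
    dominates it. *)
Lemma phase_arith d B M m p i u q w : 0 < d -> 1 < B -> 8 * d ^ 3 <= B -> m <= M ->
    32 * d ^ 3 * M <= p -> u * B ^ i <= M -> B ^ i <= M -> q.-1 * B ^ i.+1 <= m ->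
    p <= (4 * d) ^ i * w ->
  2 * ((u + q).+1 * (i.+1.*2.+2 * d ^ i.+1.*2.+1)) <= w.
Proof.
move=> d0 B1 dB mM Mp uB BM qB pw; have B0 := ltnW B1.
have qB' : q * B ^ i <= m + B ^ i.
  have : q.-1 * B ^ i <= m by apply: leq_trans qB; rewrite leq_mul2l expnS leq_pmull ?orbT.
  by case: (q) => // q'; rewrite mulSn addnC leq_add2r.
have uqB : (u + q).+1 * B ^ i <= 4 * M.
  rewrite -addn1 !mulnDl mul1n; move: mM uB BM qB'; clear.
  by move: (B ^ i) (u * _) (q * _); lia.
have i2 : i.+1.*2.+2 <= 4 * 2 ^ i.
  by have : i < 2 ^ i by [apply: ltn_expl]; clear; move: (2 ^ i); lia.
have kap : i.+1.*2.+2 * d ^ i.+1.*2.+1 <= 4 * d ^ 3 * (2 * d ^ 2) ^ i.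
  have -> : d ^ i.+1.*2.+1 = d ^ 3 * (d ^ 2) ^ i.
    by rewrite -expnM -expnD; congr (_ ^ _); lia.
  by rewrite (expnMn 2) mulnACA leq_mul2r i2 orbT.
have K0 : 0 < (4 * d) ^ i * B ^ i by rewrite muln_gt0 !expn_gt0 muln_gt0 /= d0 B0.
rewrite -(leq_pmul2l K0).
have le1 : (4 * d) ^ i * B ^ i * (2 * ((u + q).+1 * (i.+1.*2.+2 * d ^ i.+1.*2.+1))) <=
    2 * (4 * M * (4 * d ^ 3 * (2 * d ^ 2) ^ i)) * (4 * d) ^ i.
  rewrite -mulnA mulnC leq_mul2r; apply/orP; right.
  rewrite mulnCA leq_mul2l /= mulnA [B ^ i * _]mulnC; exact: leq_mul uqB kap.
have le2 : 2 * (4 * M * (4 * d ^ 3 * (2 * d ^ 2) ^ i)) * (4 * d) ^ i <= p * B ^ i.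
  have -> : 2 * (4 * M * (4 * d ^ 3 * (2 * d ^ 2) ^ i)) * (4 * d) ^ i =
      32 * d ^ 3 * M * (8 * d ^ 3) ^ i.
    have -> : 8 * d ^ 3 = 2 * d ^ 2 * (4 * d) by rewrite (expnSr d 2); lia.
    rewrite (expnMn (2 * d ^ 2)); move: (_ ^ i) ((4 * d) ^ i) (d ^ 3) => a b c.
    by lia.
  by apply: leq_mul => //; case: (i) => // j; rewrite leq_exp2r.
apply: leq_trans le1 (leq_trans le2 _).
by rewrite mulnAC leq_mul2r pw orbT.
Qed.

Section Embedding.
Variables (V : finType) (e : rel V) (X : {set V}) (m D B : nat).
Hypotheses (sym_e : symmetric e) (jG : joined e m) (m_gt0 : 0 < m).
Variables (T : finType) (r : T) (pa : T -> T) (dep : T -> nat) (delta : nat).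
Hypothesis pa_r : pa r = r.
Hypothesis dep_r : dep r = 0.
Hypothesis dep_pa : forall t, t != r -> dep t = (dep (pa t)).+1.
Hypothesis card_pa : forall w, #|[set t | pa t == w]| <= delta.

(** The guards remove the loop that [pa r = r] would create at the root. *)
Definition tadj t t' := (t != r) && (t' == pa t) || (t' != r) && (t == pa t').
Hypothesis card_tadj : forall t, #|[set t' | tadj t t']| <= delta.
Hypotheses (B_gt1 : 1 < B) (dBD : delta + B <= D).

(* I is the set of inner vertices of the tree, P the set of parents of leaves. *)
Variables (I P : {set T}).
Hypotheses (I_pa : forall t, t \in I -> pa t \in I) (PI : P \subset I).

Variable M0 : nat.
Hypotheses (m_M0 : m <= M0) (X_M0 : #|X| <= M0).
Hypothesis budget : #|X| + #|I| + (m.*2 + M0).*2 + D.*2.+1 * m <= #|V|.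

Local Notation ext := (extendable e X m D).
Local Notation anc := (anc pa dep).
Local Notation desc := (desc pa dep).

Implicit Types (S F : {set T}) (f : T -> V) (par : V -> option V).

(** A partial embedding of a subtree [S] containing the root. Only vertices of [P] may be sent into
    [X], and every image outside [X] is claimed. Claims run along tree edges in either direction,
    since linking paths are claimed from both ends. *)
Record emb S f par : Prop := Emb {
  emb_root : r \in S;
  emb_sub : S \subset I;
  emb_pa : forall t, t \in S -> pa t \in S;
  emb_inj : {in S &, injective f};
  emb_edge : forall t, t \in S -> t != r -> e (f (pa t)) (f t);
  emb_X : forall t, t \in S -> f t \in X -> t \in P;
  emb_claimed : forall t, t \in S -> f t \notin X -> par (f t) != None;
  emb_par : forall x y, par y = Some x ->
    exists t t', [/\ t \in S, t' \in S, tadj t t', f t = x & f t' = y];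
  emb_parX : forall y, par y != None -> y \notin X;
  emb_ext : ext par }.

Definition state_le S f par S' f' par' :=
  [/\ S \subset S', {in S, f' =1 f} & par_le par par'].

Definition uncovered S f := X :\: f @: S.

Lemma state_le_trans S1 f1 par1 S2 f2 par2 S3 f3 par3 :
  state_le S1 f1 par1 S2 f2 par2 -> state_le S2 f2 par2 S3 f3 par3 ->
  state_le S1 f1 par1 S3 f3 par3.
Proof.
case=> sS12 f12 p12 [sS23 f23 p23]; split; first exact: subset_trans sS12 sS23.
  by move=> t tS; rewrite f23 ?f12 // (subsetP sS12).
exact: par_le_trans p12 p23.
Qed.

Lemma uncovered_le S f par S' f' par' : state_le S f par S' f' par' ->
  uncovered S' f' \subset uncovered S f.
Proof.
case=> /subsetP sS ff _; apply: setDS; apply/subsetP => _ /imsetP[t tS ->].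
by apply/imsetP; exists t; rewrite ?ff ?sS.
Qed.

Lemma emb_claims S f par t : emb S f par -> t \in S -> #|claims par (f t)| <= delta.
Proof.
move=> E tS; apply: leq_trans (card_tadj t).
have sub : claims par (f t) \subset f @: [set t' | tadj t t'].
  apply/subsetP => y; rewrite inE => /eqP/(emb_par E)[t1 [t2 [t1S t2S adj f1 <-]]].
  by rewrite -(emb_inj E t1S tS f1) imset_f // inE.
by apply: leq_trans (subset_leq_card sub) (leq_imset_card _ _).
Qed.

Lemma emb_unclaiming S f par x : emb S f par -> x \notin f @: S -> claims par x = set0.
Proof.
move=> E xS; apply/setP => y; rewrite !inE; apply/negP => /eqP/(emb_par E)[t [_ [tS _ _ fx _]]].
by case/negP: xS; apply/imsetP; exists t.
Qed.

Lemma emb_wf S f par : emb S f par -> wf_claims e X par.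
Proof.
move=> E x y pyx; have yX : y \notin X by apply: (emb_parX E); rewrite pyx.
have [t [t' [tS t'S adj fx fy]]] := emb_par E pyx; rewrite -fx -fy in yX *; split=> //.
  case/orP: adj => /andP[nr /eqP def]; rewrite def; last exact: (emb_edge E t'S nr).
  by rewrite sym_e; apply: (emb_edge E tS nr).
by case: (boolP (f t \in X)) => //= nX; apply: (emb_claimed E).
Qed.

Lemma emb_size S f par : emb S f par -> #|X :|: claimed par| <= #|X| + #|I|.
Proof.
move=> E; have sub : X :|: claimed par \subset X :|: f @: S.
  apply/setUS/subsetP => y; rewrite inE; case py: (par y) => [x|//] _.
  by have [_ [t' [_ t'S _ _ <-]]] := emb_par E py; apply: imset_f.
apply: leq_trans (subset_leq_card sub) _; apply: leq_trans (leq_card_setU _ _) _.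
rewrite leq_add2l; apply: leq_trans (leq_imset_card _ _) _.
exact: subset_leq_card (emb_sub E).
Qed.

Definition set_at f t (y : V) : T -> V := fun s => if s == t then y else f s.

Lemma emb_step S f par t : emb S f par -> t \in I -> t \notin S -> pa t \in S ->
  exists f' par', emb (t |: S) f' par' /\ state_le S f par (t |: S) f' par'.
Proof.
move=> E tI tS ptS; have cl := emb_claims E ptS.
have [||y [ey yX py exty]] := claim_step jG m_gt0 (emb_ext E) (s := f (pa t)).
- by lia.
- by have := emb_size E; lia.
have t_nr : t != r by apply: contraNneq tS => ->; apply: emb_root E.
have fS s : s \in S -> set_at f t y s = f s.
  by rewrite /set_at; case: eqP => // ->; rewrite (negbTE tS).
have ft : set_at f t y t = y by rewrite /set_at eqxx.
have yS s : s \in S -> f s <> y.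
  move=> sS fsy; have := emb_claimed E sS; rewrite fsy py eqxx => /(_ yX).
  by [].
have le_par := par_le_add (f (pa t)) py.
exists (set_at f t y), (add_claim par (f (pa t)) y); split; last first.
  by split; rewrite ?subsetUr.
split=> //.
- by rewrite in_setU1 (emb_root E) orbT.
- by rewrite subUset sub1set tI (emb_sub E).
- by move=> s /setU1P[->|/(emb_pa E) psS]; rewrite in_setU1 ?ptS ?psS orbT.
- move=> s1 s2 /setU1P[->|s1S] /setU1P[->|s2S] //; rewrite ?ft ?fS //.
  + by move=> /esym/(yS _ s2S).
  + by move/(yS _ s1S).
  + exact: (emb_inj E).
- move=> s /setU1P[->|sS] nr; first by rewrite ft fS.
  by rewrite !fS ?(emb_pa E) //; apply: (emb_edge E).
- move=> s /setU1P[->|sS]; first by rewrite ft (negbTE yX).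
  by rewrite fS //; apply: (emb_X E).
- move=> s /setU1P[->|sS]; first by rewrite ft /add_claim eqxx.
  by rewrite fS // => fX; have nP := emb_claimed E sS fX; rewrite le_par.
- move=> x z; rewrite /add_claim; case: (eqVneq z y) => [-> [<-]|_ /(emb_par E)].
    exists (pa t), t; rewrite setU11 in_setU1 ptS orbT ft fS //; split=> //.
    by rewrite /tadj t_nr eqxx orbT.
  case=> [t1 [t2 [t1S t2S adj f1 f2]]].
  by exists t1, t2; rewrite !in_setU1 t1S t2S !orbT !fS.
- move=> z; rewrite /add_claim; case: (eqVneq z y) => [->//|_]; exact: (emb_parX E).
Qed.

Lemma emb_anc S f par t : emb S f par -> t \in I -> exists f' par',
  emb (S :|: anc t) f' par' /\ state_le S f par (S :|: anc t) f' par'.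
Proof.
move=> E; move: {2}(dep t) (leqnn (dep t)) => n; elim: n t => [|n IH] t le_t tI.
  have tr : t = r by apply/eqP; apply: contraTT le_t => /dep_pa->.
  have sub : anc t \subset S by rewrite tr anc_r // sub1set (emb_root E).
  by rewrite (setUidPl sub); exists f, par; split; [exact: E|split].
have [tS|tS] := boolP (t \in S).
  have sub : anc t \subset S by apply: anc_closed tS; apply: emb_pa E.
  rewrite (setUidPl sub).
  by exists f, par; split; [exact: E|split].
have nr : t != r by apply: contraNneq tS => ->; apply: emb_root E.
have [|f1 [par1 [E1 le1]]] := IH (pa t) _ (I_pa tI); first by rewrite dep_pa // in le_t.
rewrite (anc_pa dep_pa) // setUCA.
have [tS1|tS1] := boolP (t \in S :|: anc (pa t)).
  by rewrite (setUidPr _) ?sub1set //; exists f1, par1.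
have [|f2 [par2 [E2 le2]]] := emb_step E1 tI tS1.
  by rewrite in_setU anc_refl orbT.
by exists f2, par2; split; [exact: E2|exact: state_le_trans le1 le2].
Qed.

Lemma emb_link k S f par p : emb S f par -> p \in P ->
    iter k.*2.+1 pa p \in S -> iter k.*2 pa p \notin S ->
    linkable e X m D par k (f (iter k.*2.+1 pa p)) (uncovered S f) ->
  exists S' f' par', [/\ emb S' f' par', state_le S f par S' f' par',
    S' \subset S :|: anc p & #|uncovered S' f'| < #|uncovered S f|].
Proof.
move=> E pP aS bS [par2 [u [z [[uU sz unq fre pth] [le2 ext2 inf]]]]].
set a := iter _ pa p in aS pth inf; set l := k.*2.+1 in a aS pth inf.
have [uX uS] : u \in X /\ u \notin f @: S by move: uU; rewrite inE => /andP[].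
have itS i : i < l -> iter i pa p \notin S.
  move=> lt_i; apply: contra bS => /(iter_closed (k.*2 - i)) => /(_ pa (emb_pa E)).
  by rewrite -iterD subnK.
have itnr i : i < l -> iter i pa p != r.
  by move=> /itS; apply: contraNneq => ->; apply: emb_root E.
have dep_p i : i < l -> dep p = i + dep (iter i pa p).
  by move=> /itnr; apply: dep_iter.
have l_dep i : i < l -> i <= dep p by move/dep_p->; rewrite leq_addr.
pose tl := traject pa p l.
have tlP t : reflect (exists2 i, i < l & t = iter i pa p) (t \in tl).
  exact: trajectP.
have tl_uniq : uniq tl.
  rewrite -[tl]map_id; apply: (@map_uniq _ _ dep); rewrite map_id.
  have -> : map dep tl = map (fun i => dep p - i) (iota 0 l).
    apply: (@eq_from_nth _ 0); rewrite ?size_map ?size_iota ?size_traject // => i lt_i.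
    rewrite (nth_map p) ?size_traject // (nth_map 0) ?size_iota // nth_iota //.
    by rewrite nth_traject // add0n (dep_p i lt_i) addKn.
  rewrite map_inj_in_uniq ?iota_uniq // => i j.
  by rewrite !mem_iota !add0n => /l_dep ? /l_dep ? /eqP; rewrite eqn_sub2lE // => /eqP.
have idx i : i < l -> index (iter i pa p) tl = i.
  by move=> lt_i; rewrite -(nth_traject pa lt_i) index_uniq ?size_traject.
pose s := u :: rcons z (f a).
have sz_s : size s = l.+1 by rewrite /= size_rcons sz.
pose f' t := if t \in tl then nth (f a) s (index t tl) else f t.
have f'S t : t \in S -> f' t = f t.
  move=> tS; rewrite /f'; case: tlP => // -[i lt_i ti].
  by have := itS i lt_i; rewrite -ti tS.
have f'it i : i <= l -> f' (iter i pa p) = nth (f a) s i.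
  rewrite leq_eqVlt => /orP[/eqP->|lt_i].
    rewrite f'S // -/a /s -cat1s -rcons_cat nth_rcons /= sz.
    by rewrite /l ltnn eqxx.
  by rewrite /f' idx //; case: tlP => // -[]; exists i.
have nth_s i : i < l -> nth (f a) s i \in u :: z.
  move=> lt_i; rewrite /s -rcons_cons nth_rcons /= sz lt_i mem_nth //= sz.
  by [].
have s_inj i j : i < l -> j < l -> nth (f a) s i = nth (f a) s j -> i = j.
  have unq' : uniq (u :: z).
    rewrite /= unq andbT; apply/negP => /(allP fre)/= /andP[_].
    by rewrite uX.
  move=> lt_i lt_j; rewrite /s -rcons_cons !nth_rcons /= sz lt_i lt_j.
  by move/eqP; rewrite nth_uniq /= ?sz // => /eqP.
have zS v : v \in u :: z -> v \notin f @: S.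
  rewrite inE => /orP[/eqP->//|/(allP fre)/= /andP[/eqP pv vX]].
  apply/negP => /imsetP[t tS vt]; rewrite vt in pv vX.
  by have := emb_claimed E tS vX; rewrite pv.
have s_edge i : i < l -> e (nth (f a) s i) (nth (f a) s i.+1).
  by move=> lt_i; have /pathP := pth => /(_ (f a) i); rewrite size_rcons sz => /(_ lt_i).
pose par' v := if v \in z then par2 v else par v.
have zfree v : v \in z -> par v = None by move/(allP fre) => /= /andP[/eqP].
have le' : par_le par par'.
  by move=> v pv; rewrite /par'; case: ifP => // /zfree pv0; rewrite pv0 in pv.
have le2' : par_le par' par2.
  by move=> v; rewrite /par'; case: ifP => // _; apply: le2.
pose S' := S :|: [set t in tl].
have S'P t : t \in S' -> t \in S \/ exists2 i, i < l & t = iter i pa p.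
  by rewrite in_setU => /orP[|]; [left|rewrite inE => /tlP; right].
have itS' i : i <= l -> iter i pa p \in S'.
  rewrite leq_eqVlt => /orP[/eqP->|lt_i]; first by rewrite in_setU aS.
  by rewrite in_setU inE; apply/orP; right; apply/tlP; exists i.
have SS' t : t \in S -> t \in S' by rewrite in_setU => ->.
have sleS : state_le S f par S' f' par' by split=> //; apply: subsetUl.
have infix_it s1 s2 x y : s = s1 ++ [:: x; y] ++ s2 ->
    [/\ size s1 < l, f' (iter (size s1) pa p) = x & f' (iter (size s1).+1 pa p) = y].
  move=> def_s; have lt1 : size s1 < l.
    by rewrite -ltnS -sz_s def_s size_cat /= !addnS !ltnS leq_addr.
  rewrite !f'it ?(ltnW lt1) // def_s; split=> //.
    by rewrite nth_cat ltnn subnn.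
  by rewrite nth_cat ltnNge leqnSn /= subSnn.
have E' : emb S' f' par'.
  split.
  - by rewrite SS' // (emb_root E).
  - apply/subsetP => t /S'P[/(subsetP (emb_sub E))//|[i _ ->]].
    by apply: iter_closed => //; apply: (subsetP PI).
  - move=> t /S'P[tS|[i lt_i ->]]; first by rewrite SS' ?(emb_pa E).
    exact: (itS' i.+1).
  - move=> t t' /S'P[tS|[i lt_i ->]] /S'P[t'S|[j lt_j ->]].
    + by rewrite !f'S //; apply: (emb_inj E).
    + rewrite f'S // f'it ?(ltnW lt_j) // => ft; case/negP: (zS _ (nth_s j lt_j)).
      by rewrite -ft imset_f.
    + rewrite f'it ?(ltnW lt_i) // f'S // => ft; case/negP: (zS _ (nth_s i lt_i)).
      by rewrite ft imset_f.
    + by rewrite !f'it ?(ltnW lt_i) ?(ltnW lt_j) // => /s_inj->.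
  - move=> t /S'P[tS|[i lt_i ->]] nr.
      by rewrite !f'S ?(emb_pa E) //; apply: (emb_edge E).
    by rewrite -iterS !f'it ?(ltnW lt_i) // sym_e s_edge.
  - move=> t /S'P[tS|[i lt_i ->]]; first by rewrite f'S //; apply: (emb_X E).
    rewrite f'it ?(ltnW lt_i) // /s -rcons_cons nth_rcons /= sz lt_i.
    case: i lt_i => [//|i] lt_i /= zX.
    have /(allP fre)/= : nth (f a) z i \in z by rewrite mem_nth // sz.
    by rewrite zX andbF.
  - move=> t /S'P[tS|[i lt_i ->]].
      by rewrite f'S // => fX; have pn := emb_claimed E tS fX; rewrite le'.
    rewrite f'it ?(ltnW lt_i) // => fX; have := nth_s i lt_i.
    rewrite inE => /orP[/eqP fu|fz]; first by rewrite fu uX in fX.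
    by rewrite /par' fz; have [x [-> _]] := inf _ fz.
  - move=> x y; rewrite /par'; case: ifP => [yz|_ /(emb_par E)[t [t' [tS t'S adj fx fy]]]].
      have [x' [-> nb]] := inf _ yz; case=> <-.
      (* On the half grown from [u] a child claims its parent in the tree; on the other half a
         parent claims its child. *)
      case: nb => /infixP[s1 [s2 def_s]];
        have [lt1 f1 f2] := infix_it _ _ _ _ def_s; rewrite -f1 -f2.
        exists (iter (size s1) pa p), (iter (size s1).+1 pa p).
        by rewrite !itS' ?(ltnW lt1) // /tadj itnr //= eqxx.
      exists (iter (size s1).+1 pa p), (iter (size s1) pa p).
      by rewrite !itS' ?(ltnW lt1) // /tadj [iter (size s1) pa p != r]itnr //= eqxx orbT.
    by exists t, t'; rewrite !SS' // !f'S.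
  - move=> y; rewrite /par'; case: ifP => [/(allP fre)/= /andP[]//|_].
    exact: (emb_parX E).
  - exact: extendable_le le2' ext2.
exists S', f', par'; split=> //.
  apply/setUS/subsetP => t; rewrite inE => /tlP[i lt_i ->].
  by apply: anc_iter; apply: l_dep.
apply: proper_card; rewrite properE (uncovered_le sleS) /=.
apply/subsetPn; exists u => //; rewrite inE uX andbT negbK.
apply/imsetP; exists p; first exact: (itS' 0).
by rewrite (f'it 0).
Qed.

(** The tree is embedded down to [a], which lies [2k+1] levels above [p], and a link is tried there.
    Success covers a new vertex of [X]; failure puts [a] into the set [F] of failed vertices, and
    the embedding continues to [p]. Either way [#|uncovered S f| - #|F|] drops. *)
Lemma emb_iteration k S f par F p : emb S f par -> p \in P -> F \subset S ->
    (forall a, a \in F -> ~ linkable e X m D par k (f a) (uncovered S f)) ->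
    iter k.*2.+1 pa p \notin S ->
  exists S' f' par' F', [/\ emb S' f' par', state_le S f par S' f' par',
    S' \subset S :|: anc p & F' \subset S'] /\
    ((forall a, a \in F' -> ~ linkable e X m D par' k (f' a) (uncovered S' f')) /\
     #|uncovered S' f'| + #|F| < #|uncovered S f| + #|F'|).
Proof.
move=> E pP FS nlF aS; set a := iter _ pa p in aS.
have pI := subsetP PI _ pP.
have aI : a \in I by apply: iter_closed.
have a_nr : a != r by apply: contraNneq aS => ->; apply: emb_root E.
have dep_a : dep p = k.*2.+1 + dep a by exact: (dep_iter pa_r dep_pa a_nr).
have a_anc : a \in anc p by apply: anc_iter; rewrite dep_a leq_addr.
have [f1 [par1 [E1 le1]]] := emb_anc E aI; set S1 := S :|: anc a in E1 le1.
have aS1 : a \in S1 by rewrite in_setU anc_refl orbT.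
have S1p : S1 \subset S :|: anc p.
  by apply/setUS/subsetP => t; exact: (anc_trans dep_r dep_pa a_anc).
have bS1 : iter k.*2 pa p \notin S1.
  rewrite in_setU negb_or; apply/andP; split.
    by apply: contra aS; apply: (emb_pa E).
  apply/negP => /(anc_dep dep_r dep_pa); have : iter k.*2 pa p != r.
    by apply: contraNneq a_nr => br; rewrite /a /= br pa_r.
  by move/(dep_iter pa_r dep_pa); move: dep_a; clear; lia.
have pers S2 f2 par2 b : state_le S f par S2 f2 par2 -> b \in F ->
    ~ linkable e X m D par2 k (f2 b) (uncovered S2 f2).
  move=> le2 bF lk; have [_ f12 p12] := le2; apply: (nlF b bF).
  rewrite -(f12 b (subsetP FS b bF)).
  exact: linkable_le p12 (uncovered_le le2) lk.
have [lk|nlk] := EM (linkable e X m D par1 k (f1 a) (uncovered S1 f1)).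
  have [S2 [f2 [par2 [E2 le2 sub2 lt2]]]] := emb_link E1 pP aS1 bS1 lk.
  have le12 := state_le_trans le1 le2.
  exists S2, f2, par2, F; split; first split=> //.
  - by apply: subset_trans sub2 _; rewrite subUset S1p subsetUr.
  - by case: le12 => sS _ _; apply: subset_trans FS sS.
  split=> [b|]; first exact: pers.
  rewrite ltn_add2r; apply: leq_trans lt2 _.
  exact: subset_leq_card (uncovered_le le1).
have [f2 [par2 [E2 le2]]] := emb_anc E1 pI; set S2 := S1 :|: anc p in E2 le2.
have le12 := state_le_trans le1 le2.
exists S2, f2, par2, (a |: F); split; first split=> //.
- by rewrite subUset S1p subsetUr.
- rewrite subUset sub1set; case: (le2) => sS2 _ _; rewrite (subsetP sS2) //.
  by case: le12 => sS _ _; apply: subset_trans FS sS.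
split=> [b /setU1P[->|]|]; last 1 first.
- rewrite cardsU1; have -> : a \notin F by apply: contra aS; apply: (subsetP FS).
  by have := subset_leq_card (uncovered_le le12); clear; lia.
- have [_ f12 p12] := le2 => lk; apply: nlk; rewrite -(f12 a aS1).
  exact: linkable_le p12 (uncovered_le le2) lk.
- exact: pers.
Qed.

(** * The phases that cover [X] *)

Definition eligible S W l := [set p in P :&: W | iter l pa p \notin S].

(** An eligible [q] is lost only if its [l]-th ancestor is an ancestor of [p]. As [p] has least
    depth, that ancestor is at most [l] levels above [p], which leaves [l.+1] choices, each serving
    at most [delta ^ l] vertices [q]. *)
Lemma eligible_killed S S' W l p : p \in eligible S W l ->
    (forall t, t \in S -> pa t \in S) -> r \in S ->
    (forall p', p' \in eligible S W l -> dep p <= dep p') -> S' \subset S :|: anc p ->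
  #|eligible S W l| <= l.+1 * delta ^ l + #|eligible S' W l|.
Proof.
move=> pe clS rS pmin sub.
have depl q : q \in eligible S W l -> dep q = l + dep (iter l pa q).
  rewrite inE => /andP[_ qS]; apply: (dep_iter pa_r dep_pa).
  by apply: contraNneq qS => ->.
pose K := \bigcup_(j < l.+1) [set t | iter l pa t == iter j pa p].
have cK : #|K| <= l.+1 * delta ^ l.
  apply: leq_trans (leq_card_bigcup _ _) _.
  apply: leq_trans (leq_sum _ (E2 := fun=> delta ^ l) _) _ => [j _|].
    exact: card_iter_pa.
  by rewrite sum_nat_const card_ord.
apply: leq_trans (leq_add cK (leqnn _)); apply: leq_trans (leq_card_setU _ _).
apply/subset_leq_card/subsetP => q qe; have [dq dp] := (depl _ qe, depl _ pe).
have := qe; rewrite in_setU [q \in eligible _ _ _]inE [X in _ || X]inE => /andP[-> qS] /=.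
case: (boolP (_ \in S')) => [/(subsetP sub)|]; rewrite ?orbT //.
rewrite in_setU (negbTE qS) /= => /ancP[j le_j jq]; rewrite orbF; apply/bigcupP.
have lt_j : j < l.+1.
  have := pmin _ qe; have := dep_iterB dep_r dep_pa le_j; rewrite jq; lia.
by exists (Ordinal lt_j); rewrite // inE /= jq.
Qed.

(** Otherwise the images of [F] and the uncovered part of [X] both have at least [q] elements, and
    [linkable_ex] links a vertex whose attempt failed. *)
Lemma failures_lt k q S f par F : m <= q * B ^ k -> k <= M0 -> emb S f par ->
    F \subset S -> (forall a, a \in F -> ~ linkable e X m D par k (f a) (uncovered S f)) ->
  q <= #|uncovered S f| -> #|F| < q.
Proof.
move=> qk kM E FS nlF qU; rewrite ltnNge; apply/negP => qF.
have [|||||||||y /imsetP[a aF ->]] := @linkable_ex _ e X m D jG m_gt0 B B_gt1 _ par k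
    (f @: F) (uncovered S f) sym_e (emb_ext E) (emb_wf E); last exact: nlF.
- by apply: leq_trans dBD; apply: leq_addl.
- move=> _ /imsetP[t tF ->]; case: (boolP (f t \in X)) => //=.
  by apply: (emb_claimed E); apply: (subsetP FS).
- move=> _ /imsetP[t tF ->]; apply: leq_trans dBD.
  by rewrite leq_add2r (emb_claims E (subsetP FS _ tF)).
- exact: subsetDl.
- by move=> u; rewrite inE => /andP[uS _]; apply: emb_unclaiming E _.
- rewrite disjoint_subset; apply/subsetP => _ /imsetP[t tF ->].
  by rewrite !inE imset_f // (subsetP FS).
- rewrite card_in_imset ?(leq_trans qk) ?leq_mul2r ?qF ?orbT //.
  by move=> t t' tF t'F; apply: (emb_inj E); apply: (subsetP FS).
- by apply: leq_trans qk _; rewrite leq_mul2r qU orbT.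
- apply: leq_trans budget; rewrite leq_add2r leq_add ?(emb_size E) //.
  by rewrite leq_double leq_add2l.
Qed.

(** [N] bounds the number of iterations left: each lowers [#|uncovered S f| - #|F|], and there are
    fewer than [q] failures as long as [q] vertices are uncovered. Treating an eligible vertex of
    least depth limits the eligible vertices lost per iteration. *)
Lemma phase k q W N S f par F : m <= q * B ^ k -> k <= M0 ->
    emb S f par -> F \subset S ->
    (forall a, a \in F -> ~ linkable e X m D par k (f a) (uncovered S f)) ->
    N * (k.*2.+2 * delta ^ k.*2.+1) <= #|eligible S W k.*2.+1| ->
    #|uncovered S f| + q <= N + #|F| ->
  exists S' f' par', [/\ emb S' f' par', state_le S f par S' f' par',
    #|uncovered S' f'| < q &
    forall t, t \in S' -> t \in S \/ exists2 p, p \in P :&: W & t \in anc p].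
Proof.
move=> qk kM; elim: N S f par F => [|N IH] S f par F E FS nlF el cnt.
all: have [Uq|qU] := ltnP #|uncovered S f| q;
  first by exists S, f, par; split=> // t; left.
all: have Fq := failures_lt qk kM E FS nlF qU.
  by move: cnt Fq qU; clear; lia.
have kap : 0 < k.*2.+2 * delta ^ k.*2.+1.
  have : 0 < delta by apply: leq_trans (card_pa r); apply/card_gt0P; exists r; rewrite inE pa_r.
  by rewrite muln_gt0 expn_gt0 => ->.
have /card_gt0P[p0 p0e] : 0 < #|eligible S W k.*2.+1| by apply: leq_trans el; rewrite muln_gt0.
case: (arg_minnP dep p0e) => p pe pmin.
have [pPW pS] : p \in P :&: W /\ iter k.*2.+1 pa p \notin S.
  by have : p \in eligible S W k.*2.+1 := pe; rewrite inE => /andP.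
have pP : p \in P by case/setIP: pPW.
have [S1 [f1 [par1 [F1 [[E1 le1 sub1 F1S] [nlF1 lt1]]]]]] := emb_iteration E pP FS nlF pS.
have [||S2 [f2 [par2 [E2 le2 U2 sub2]]]] := IH S1 f1 par1 F1 E1 F1S nlF1; last first.
- exists S2, f2, par2; split=> //; first exact: state_le_trans le1 le2.
  move=> t /sub2[/(subsetP sub1)|]; last by right.
  by rewrite in_setU => /orP[|tp]; [left|right; exists p].
- by move: cnt lt1; clear; lia.
- have := eligible_killed pe (emb_pa E) (emb_root E) pmin sub1.
  move=> killed; rewrite -(leq_add2l (k.*2.+2 * delta ^ k.*2.+1)) -mulSn.
  exact: leq_trans el killed.
Qed.

Hypotheses (B_big : 8 * delta ^ 3 <= B) (P_big : 32 * delta ^ 3 * M0 <= #|P|).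

(** Induction over the phases, with [n] as fuel. At stage [i] nothing strictly below [v] is embedded
    and the subtree of [v] holds at least a [(4 delta)^-i] share of [P]. The phase consumes only
    vertices of [P] in [desc v :\: desc v'], with [v'] from [desc_split], and leaves the subtree of
    [v'] to the later phases. *)
Lemma cover_from n i v S f par : M0 < n + i -> emb S f par ->
    S :&: desc v \subset [set v] ->
    #|uncovered S f| * B ^ i <= M0 -> #|P| <= (4 * delta) ^ i * #|P :&: desc v| ->
  exists S' f' par', emb S' f' par' /\ X \subset f' @: S'.
Proof.
have d_gt0 : 0 < delta.
  by apply: leq_trans (card_pa r); apply/card_gt0P; exists r; rewrite inE pa_r.
elim: n i v S f par => [|n IH] i v S f par iM E Sv UB Pw.
all: have [BM|MB] := ltnP M0 (B ^ i).
(* Once [B ^ i] exceeds [M0], no vertex of [X] is left uncovered. *)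
1,3: by exists S, f, par; split=> //; rewrite -setD_eq0 -cards_eq0 -/(uncovered S f);
  case: #|_| UB => // u; rewrite mulSn => /(leq_trans (leq_addr _ _)); rewrite leqNgt BM.
  by have := ltn_trans iM (leq_trans (ltn_expl i B_gt1) MB); rewrite ltnn.
(* The target is [m / B^(i+1)] rounded up, the least size from which [i.+1] levels of growth reach
   [m]. *)
pose q := (m + (B ^ i.+1).-1) %/ B ^ i.+1.
have Bi_gt0 : 0 < B ^ i.+1 by rewrite expn_gt0 ltnW.
have mq : m <= q * B ^ i.+1.
  have := divn_eq (m + (B ^ i.+1).-1) (B ^ i.+1).
  have := ltn_pmod (m + (B ^ i.+1).-1) Bi_gt0; rewrite -/q.
  by move: (B ^ i.+1) (_ %% _) (q * _) Bi_gt0; clear; lia.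
have qm : q.-1 * B ^ i.+1 <= m.
  have : q * B ^ i.+1 <= m + (B ^ i.+1).-1 by apply: leq_trunc_div.
  case: (q) => // q'; rewrite mulSn /=.
  by move: (B ^ i.+1) (q' * _) Bi_gt0; clear; lia.
have := phase_arith d_gt0 B_gt1 B_big m_M0 P_big UB MB qm Pw.
set w := #|P :&: desc v|; set kap := _ * delta ^ _ => wbig.
have kap_gt0 : 0 < kap by rewrite /kap muln_gt0 expn_gt0 d_gt0.
have w_gt1 : 1 < w.
  by apply: leq_trans wbig; apply: leq_pmulr; rewrite muln_gt0 kap_gt0.
have [v' [v'v wv' wrest]] := desc_split dep_r dep_pa card_pa w_gt1.
have kM : i.+1 <= M0 by apply: leq_trans MB; apply: ltn_expl.
pose W := desc v :\: desc v'.
have elW : (#|uncovered S f| + q) * kap <= #|eligible S W i.+1.*2.+1|.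
  have sub : P :&: W \subset eligible S W i.+1.*2.+1 :|:
      [set t in P :&: desc v | iter i.+1.*2.+1 pa t \notin desc v :\ v].
    apply/subsetP => t tPW; have [tP tW] := setIP tPW; have [tv _] := setDP tW.
    rewrite in_setU [t \in eligible _ _ _]inE tPW /= [X in _ || X]inE in_setI tP tv /=.
    case: (boolP (_ \in S)) => //= tS; apply/negP => /setD1P[nv itv].
    by case/negP: nv; rewrite -in_set1; apply: (subsetP Sv); rewrite inE tS.
  have := leq_trans (subset_leq_card sub) (leq_card_setU _ _).
  have := card_shallow pa_r dep_r dep_pa card_pa P v i.+1.*2.+1; rewrite -/kap.
  move: wrest wbig; rewrite -/w -/W [_.+1 * kap]mulSn.
  by move: ((#|uncovered S f| + q) * kap) => x; clear; lia.
have [|||S1 [f1 [par1 [E1 le1 U1 sub1]]]] := @phase i.+1 q W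
    (#|uncovered S f| + q) S f par set0 mq kM E (sub0set _).
- by move=> a; rewrite inE.
- exact: elW.
- by rewrite cards0 addn0.
apply: (IH i.+1 v' S1 f1 par1) => //; first by rewrite addnS -addSn.
(* No vertex of [S1] lies in [desc v']: one from [S] could only be [v], which would make
   [desc v :\: desc v'] empty, and a new one is an ancestor of a vertex outside [desc v']. *)
- apply/subsetP => t /setIP[/sub1[tS|[p /setIP[_ /setDP[_ pv']] tp]] tv'].
    have : t \in S :&: desc v by rewrite inE tS (subsetP v'v).
    move/(subsetP Sv)/set1P => tv; rewrite tv in_desc in tv'.
    have sub : desc v \subset desc v'.
      by apply/subsetP => s; rewrite !in_desc => /(anc_trans dep_r dep_pa); apply.
    by move: wrest; rewrite (eqP (_ : desc v :\: desc v' == set0)) ?setD_eq0 //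
      setI0 cards0 muln0 leqNgt ltnW.
  case/negP: pv'; rewrite in_desc; rewrite in_desc in tv'.
  exact: (anc_trans dep_r dep_pa tp tv').
- apply: leq_trans _ m_M0; apply: leq_trans qm; rewrite leq_mul2r.
  by case: (q) U1 => // q'; rewrite ltnS => ->; rewrite orbT.
- apply: leq_trans Pw _; rewrite expnSr -[X in _ <= X]mulnA leq_mul2l.
  by rewrite wv' orbT.
Qed.

(** * Completing the inner tree and placing the leaves *)

Hypotheses (leaf_pa : forall l, l \notin I -> pa l \in P) (rP : r \in P).
Hypothesis pa_leaf : forall p, p \in P -> exists2 l, l \notin I & pa l = p.
Hypothesis card_TV : #|T| = #|V|.
Hypothesis ext0 : extendable e X m D (fun=> None).
Hypothesis expX : forall A : {set V}, #|A| <= m -> #|A| <= #|nbhd e A :&: X|.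

Lemma emb_all S f par : emb S f par -> exists f' par',
  emb I f' par' /\ state_le S f par I f' par'.
Proof.
move: {2}#|I :\: S| (leqnn #|I :\: S|) => n; elim: n S f par => [|n IH] S f par le_n E.
  have SI : S = I.
    apply/eqP; rewrite eqEsubset (emb_sub E) -setD_eq0 -cards_eq0.
    by rewrite -leqn0.
  by subst S; exists f, par; split=> //; split.
case: (set_0Vmem (I :\: S)) => [I0|[t /setDP[tI tS]]].
  by apply: IH E; rewrite I0 cards0.
have [f1 [par1 [E1 le1]]] := emb_anc E tI.
have [|f2 [par2 [E2 le2]]] := IH _ f1 par1 _ E1.
  rewrite -ltnS; apply: leq_trans le_n; apply: proper_card; rewrite properE setDS ?subsetUl //=.
  by apply/subsetPn; exists t; rewrite in_setD ?tI ?tS // in_setU anc_refl orbT.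
by exists f2, par2; split=> //; apply: state_le_trans le1 le2.
Qed.

Lemma emb_covering : exists f par, emb I f par /\ X \subset f @: I.
Proof.
have /card_gt0P[v0 _] : 0 < #|V| by rewrite -card_TV; apply/card_gt0P; exists r.
have /card_gt0P[x0 /setIP[_ x0X]] : 0 < #|nbhd e [set v0] :&: X|.
  by apply: leq_trans (expX _); rewrite cards1.
(* The root may go into [X] because it lies in [P]. Images in [X] need no claim, so the embedding
   starts without any. *)
have E0 : emb [set r] (fun=> x0) (fun=> None).
  split=> //; first by rewrite set11.
  - by rewrite sub1set (subsetP PI).
  - by move=> t /set1P->; rewrite pa_r set11.
  - by move=> t t' /set1P-> /set1P->.
  - by move=> t /set1P->; rewrite eqxx.
  - by move=> t /set1P->.
  - by move=> t _; rewrite x0X.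
have root_anc t : r \in anc t.
  have := anc_iter pa (leqnn (dep t)); rewrite (_ : iter _ _ _ = r) //.
  have := dep_iterB dep_r dep_pa (leqnn (dep t)); rewrite subnn => d0.
  by apply/eqP; apply: contra_eqT d0 => /dep_pa->.
have [|||||S [f [par [E XS]]]] := @cover_from M0.+1 0 r
    [set r] (fun=> x0) (fun=> None).
- by rewrite addn0.
- exact: E0.
- exact: subsetIl.
- rewrite muln1; apply: leq_trans X_M0; apply: subset_leq_card; exact: subsetDl.
- rewrite mul1n; apply/subset_leq_card/subsetP => t tP.
  by rewrite inE tP in_desc root_anc.
have [f1 [par1 [E1 [sS ff _]]]] := emb_all E; exists f1, par1; split=> //.
apply: subset_trans XS _; apply/subsetP => _ /imsetP[t tS ->].
by apply/imsetP; exists t; rewrite ?ff // (subsetP sS).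
Qed.

(** Let [Q] be the image of the parents of [A]. If it has at most [2m] elements, extendability gives
    it [D * #|Q|] available neighbours, at most [delta * #|Q|] of them claimed, and [D] is at least
    [2 delta]. If it is larger, it sees every leftover vertex except a set [B0] of size at most [m],
    and [B0] is no larger than the set of leaves outside [A]. *)
Lemma leaves_hall f par (A : {set T}) : emb I f par -> X \subset f @: I ->
    A \subset ~: I ->
  #|A| <= #|[set b | [exists a in A, e (f (pa a)) b && (b \notin f @: I)]]|.
Proof.
move=> E XI AL; set N := [set b | _].
pose Q := f @: (pa @: A).
have paAP : pa @: A \subset P.
  by apply/subsetP => _ /imsetP[a aA ->]; apply: leaf_pa; have := subsetP AL _ aA; rewrite inE.
have paAI := subset_trans paAP PI.
have cQ : #|Q| = #|pa @: A|.
  by apply: card_in_imset => s t sA tA; apply: (emb_inj E); apply: (subsetP paAI).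
have defN : N = nbhd e Q :\: f @: I.
  apply/setP => b; rewrite inE in_setD; apply/existsP/andP.
    case=> a /andP[aA /andP[eab bI]]; split=> //; apply/nbhdP; exists (f (pa a)) => //.
    by rewrite !imset_f.
  case=> bI /nbhdP[_ /imsetP[_ /imsetP[a aA ->] ->] eab].
  by exists a; rewrite aA eab.
have [Qm|mQ] := leqP #|Q| m.*2.
  have cA : #|A| <= delta * #|Q|.
    have sub : A \subset \bigcup_(p in pa @: A) [set t | pa t == p].
      apply/subsetP => a aA; apply/bigcupP; exists (pa a); last by rewrite inE.
      exact: imset_f.
    apply: leq_trans (subset_leq_card sub) _; apply: leq_trans (leq_card_bigcup _ _) _.
    apply: leq_trans (leq_sum _ (E2 := fun=> delta) _) _ => [p _|]; first exact: card_pa.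
    by rewrite sum_nat_const cQ mulnC.
  have := extendableP (emb_ext E) Qm.
  have : #|nbhd (avail e X par) Q| <= #|N| + delta * #|Q|.
    have sub : nbhd (avail e X par) Q \subset N :|: \bigcup_(x in Q) claims par x.
      apply/subsetP => y /nbhdP[x xQ /and3P[exy yX py]]; rewrite in_setU.
      case/orP: py => [/eqP py|py]; last first.
        by apply/orP; right; apply/bigcupP; exists x; rewrite // inE.
      apply/orP; left; rewrite defN in_setD; apply/andP; split; last first.
        by apply/nbhdP; exists x.
      apply/negP => /imsetP[t tI yt]; rewrite yt in py yX.
      by have := emb_claimed E tI yX; rewrite py.
    apply: leq_trans (subset_leq_card sub) _; apply: leq_trans (leq_card_setU _ _) _.
    rewrite leq_add2l; apply: leq_trans (leq_card_bigcup _ _) _.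
    apply: leq_trans (leq_sum _ (E2 := fun=> delta) _) _ => [x|].
      case/imsetP => t tA ->; apply: (emb_claims E).
      exact: (subsetP paAI).
    by rewrite sum_nat_const mulnC.
  have : (delta + delta) * #|Q| <= D * #|Q|.
    rewrite leq_mul2r; apply/orP; right; apply: leq_trans dBD; rewrite leq_add2l.
    by apply: leq_trans B_big; move: delta; clear; case=> // d; rewrite !expnS; nia.
  rewrite mulnDl; move: cA; clear; lia.
pose B0 := ~: (f @: I) :\: nbhd e Q.
have cI : #|f @: I| = #|I| by apply: card_in_imset; apply: (emb_inj E).
have B0m : #|B0| <= m.
  apply: ltnW; apply: leq_ltn_trans (joined_nbhd jG (A := Q) _).
    by apply: subset_leq_card; rewrite /B0 setDE subsetIr.
  by apply: leq_trans (ltnW mQ); rewrite -addnn leq_addr.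
(* A neighbour of [B0] in [X] is the image of some [p] in [P] outside [pa @: A], so every leaf at
   [p] lies outside [A]. *)
have B0L : #|B0| <= #|(~: I) :\: A|.
  apply: leq_trans (expX B0m) _.
  have sub : nbhd e B0 :&: X \subset (f \o pa) @: ((~: I) :\: A).
    apply/subsetP => x /setIP[/nbhdP[b bB ebx] xX].
    have /imsetP[p pI xp] := subsetP XI _ xX.
    have pP : p \in P by apply: (emb_X E) => //; rewrite -xp.
    have [l lI lp] := pa_leaf pP; apply/imsetP; exists l; last by rewrite /= lp.
    rewrite !inE lI andbT; apply/negP => lA; move: bB; rewrite inE => /andP[/nbhdP[]].
    by exists x; [rewrite xp -lp !imset_f|rewrite sym_e].
  by apply: leq_trans (subset_leq_card sub) (leq_imset_card _ _).
have cN : #|N| + #|B0| = #|~: (f @: I)|.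
  by rewrite defN /B0 [nbhd e Q :\: _]setDE setIC cardsID.
have := cardsC (f @: I); have := cardsC I; have := cardsID A (~: I).
rewrite (setIidPr AL) cI card_TV; move: cN B0L; clear; lia.
Qed.

Lemma spanning_embedding : exists2 g : T -> V, injective g &
  forall t, t != r -> e (g (pa t)) (g t).
Proof.
have [f [par [E XI]]] := emb_covering.
have [h h_inj hR] := hall (f r) (fun A => leaves_hall E XI (A := A)).
exists (fun t => if t \in I then f t else h t) => [s t|t nr].
  have hI u v : u \notin I -> v \in I -> h u <> f v.
    move=> uI vI huv; have := hR u; rewrite inE uI => /(_ isT)/andP[_].
    by rewrite huv imset_f.
  case: (boolP (s \in I)) => sI; case: (boolP (t \in I)) => tI.
  - exact: (emb_inj E).
  - by move=> /esym/(hI _ _ tI sI).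
  - by move/(hI _ _ sI tI).
  - by apply: h_inj; rewrite inE.
case: (boolP (t \in I)) => tI; first by rewrite I_pa //; apply: (emb_edge E).
rewrite (subsetP PI) ?leaf_pa //; have := hR t; rewrite inE tI => /(_ isT).
by case/andP.
Qed.
End Embedding.

(** * Rooting a tree *)


(** [dep] is the distance from [r], and [pa] picks a neighbour one step closer. An edge outside the
    parent relation would close a cycle with the path joining its ends inside that relation. *)
Lemma tree_rooting (T : sgraph) (r : T) : is_tree T -> exists pa dep,
  [/\ pa r = r, dep r = 0, forall t, t != r -> dep t = (dep (pa t)).+1,
      forall t, t != r -> edge (pa t) t & forall x y : T, edge x y -> tadj r pa x y].
Proof.
case=> -[_ conn] acyc.
pose reach n (t : T) := [exists p : n.-tuple T, path (@edge T) r p && (last r p == t)].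
have reachP n t : reflect (exists p, [/\ size p = n, path (@edge T) r p & last r p = t])
    (reach n t).
  apply: (iffP existsP) => [[p /andP[pth /eqP lst]]|[p [sp pth lst]]].
    by exists p; rewrite size_tuple.
  have sp' : size p == n by rewrite sp.
  by exists (Tuple sp'); rewrite /= pth lst eqxx.
have ex_reach t : exists n, reach n t.
  have /connectP[p pth lst] := conn r t; exists (size p); apply/reachP.
  by exists p.
pose dep t := ex_minn (ex_reach t).
have dep_reach t : reach (dep t) t by rewrite /dep; case: ex_minnP.
have dep_min t n : reach n t -> dep t <= n by rewrite /dep; case: ex_minnP => k _; apply.
have dep_r : dep r = 0.
  by apply/eqP; rewrite -leqn0; apply: dep_min; apply/reachP; exists [::].
have ex_pa t : t != r -> exists x, edge x t && (dep t == (dep x).+1).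
  move=> nr; have /reachP[p [sp pth lst]] := dep_reach t.
  case/lastP: p sp pth lst => [_ _ /= rt|p y]; first by rewrite -rt eqxx in nr.
  rewrite size_rcons last_rcons rcons_path => sp /andP[pth ey] yt; subst y.
  exists (last r p); rewrite ey -sp eqSS eqn_leq /=; apply/andP; split; last first.
    by apply: dep_min; apply/reachP; exists p.
  rewrite -ltnS sp; apply: dep_min.
  have /reachP[q [sq qth lq]] := dep_reach (last r p); apply/reachP.
  by exists (rcons q t); rewrite size_rcons last_rcons rcons_path sq qth lq ey.
pose pa t := if t == r then r else odflt r [pick x | edge x t && (dep t == (dep x).+1)].
have paP t : t != r -> edge (pa t) t /\ dep t = (dep (pa t)).+1.
  move=> nr; rewrite /pa (negbTE nr); case: pickP => [x /andP[ex /eqP dx] //|no].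
  by have [x] := ex_pa t nr; rewrite no.
have symF : symmetric (tadj r pa) by move=> x y; rewrite /tadj orbC.
have F_edge x y : tadj r pa x y -> edge x y.
  case/orP=> /andP[nr /eqP->]; last by case: (paP y nr).
  by rewrite edge_sym; case: (paP x nr).
have connF x : connect (tadj r pa) x r.
  move: {2}(dep x) (leqnn (dep x)) => n; elim: n x => [|n IH] x le_n.
    by case: (eqVneq x r) => [->|/paP[_ dx]]; rewrite ?connect0 //; rewrite dx in le_n.
  case: (eqVneq x r) => [->|nr]; first exact: connect0.
  apply: connect_trans (IH (pa x) _); last by have [_ dx] := paP x nr; rewrite dx in le_n.
  by apply: connect1; rewrite /tadj nr eqxx.
exists pa, dep; split=> //; first by rewrite /pa eqxx.
- by move=> t /paP[].
- by move=> t /paP[].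
move=> x y exy; apply: contraT => nF.
have csymF : connect_sym (tadj r pa) by apply: sym_connect_sym.
have /connectP[p0 pth0 lst0] : connect (tadj r pa) x y.
  by apply: connect_trans (connF x) _; rewrite csymF.
(* The shortened path and the edge from [y] back to [x] form a cycle. It has at least three
   vertices, because [x] and [y] are distinct and not related by [tadj r pa]. *)
case/shortenP: pth0 lst0 => p pth unq _ lst.
have : ucycle (@edge T) (x :: p).
  rewrite /ucycle unq andbT /= rcons_path (sub_path F_edge pth) -lst.
  by rewrite edge_sym exy.
move/acyc; case: p pth unq lst => [|z [|z' p]] //=.
  by move=> _ _ yx; rewrite yx edge_irrefl in exy.
by move=> /andP[Fxz _] _ yz _; rewrite -yz (negbTE nF) in Fxz.
Qed.

Lemma leq_degree (T : sgraph) (t : T) : degree t <= max_degree T.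
Proof. by rewrite /max_degree (leq_bigmax t). Qed.

(** Two adjacent leaves would form a whole component. *)
Lemma leaf_neighbour (T : sgraph) (l : T) : is_tree T -> 2 < #|T| -> l \in leaves T ->
  exists2 p : T, edge l p & p \notin leaves T.
Proof.
case=> -[_ conn] _ T2; rewrite inE => /eqP/eqP/cards1P[p Np].
have el x : edge l x = (x == p) by have /setP/(_ x) := Np; rewrite !inE.
exists p; first by rewrite el.
apply/negP; rewrite inE => /cards1P[q Nq].
have ep x : edge p x = (x == l).
  have /setP/(_ l) := Nq; rewrite !inE edge_sym el eqxx => /esym/eqP lq.
  by have /setP/(_ x) := Nq; rewrite !inE lq.
have csym : connect_sym (@edge T) by apply: sym_connect_sym; apply: edge_sym.
have clo : closed (@edge T) (mem [set l; p]).
  apply: intro_closed => // x y exy; rewrite !inE => /orP[/eqP xl|/eqP xp].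
    by rewrite xl el in exy; rewrite exy orbT.
  by rewrite xp ep in exy; rewrite exy.
have : #|T| <= #|[set l; p]|.
  rewrite -cardsT; apply/subset_leq_card/subsetP => x _.
  by rewrite -[x \in _](closed_connect clo (conn l x)) !inE eqxx.
by rewrite cards2 leqNgt (leq_ltn_trans _ T2) // ltnS leq_b1.
Qed.

(** The root is a neighbour of a leaf but not a leaf itself, so it lies in both [I] and [P]. The
    strict degree bound leaves room for the root, which is its own parent and counts among its
    children. The exponent 4 arises because [P] has at least [#|leaves T| / delta] elements. *)
Lemma tree_copy (G T : sgraph) (X : {set G}) (m M delta : nat) :
    joined (@edge G) m -> 0 < m -> m <= M -> #|X| <= M ->
    extendable (@edge G) X m (delta + 8 * delta ^ 3) (fun=> None) ->
    (forall A : {set G}, #|A| <= m -> #|A| <= #|nbhd (@edge G) A :&: X|) ->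
    is_tree T -> max_degree T < delta -> #|T| = #|G| -> 2 < #|T| ->
    32 * delta ^ 4 * M <= #|leaves T| ->
  contains_copy G T.
Proof.
move=> jG m0 mM XM ext0 expX treeT degT cTG T2 big.
have d0 : 0 < delta by apply: leq_ltn_trans degT.
have M0 : 0 < M by apply: leq_trans mM.
have /card_gt0P[l0 l0L] : 0 < #|leaves T|.
  by apply: leq_trans big; rewrite 2!muln_gt0 expn_gt0 d0 M0.
have [r el0r rI] := leaf_neighbour treeT T2 l0L.
have [pa [dep [pa_r dep_r dep_pa epa eadj]]] := tree_rooting r treeT.
pose I := ~: leaves T; pose P := pa @: leaves T.
have degd (t : T) : #|[set w | edge t w]| < delta.
  by apply: leq_ltn_trans degT; apply: leq_degree.
have card_pa w : #|[set t | pa t == w]| <= delta.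
  apply: leq_trans (degd w); rewrite -add1n -(cards1 r).
  apply: leq_trans (leq_card_setU _ _); apply/subset_leq_card/subsetP => t.
  rewrite !inE => /eqP <-; case: (eqVneq t r) => //= nr; exact: epa.
have card_tadj t : #|[set t' | tadj r pa t t']| <= delta.
  apply: leq_trans (ltnW (degd t)); apply/subset_leq_card/subsetP => t'.
  rewrite !inE => /orP[] /andP[nr /eqP->]; last exact: epa.
  by rewrite edge_sym; apply: epa.
have paI t : pa t \in I.
  rewrite inE; case: (eqVneq t r) => [->|nr]; first by rewrite pa_r.
  case: (eqVneq (pa t) r) => [->//|npr].
  rewrite inE; apply/negP => /cards1P[z Nz].
  have /setP/(_ t) := Nz; rewrite !inE epa // => /esym/eqP tz.
  have /setP/(_ (pa (pa t))) := Nz; rewrite !inE edge_sym epa // => /esym/eqP ppz.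
  by have := dep_pa _ nr; rewrite (dep_pa _ npr) ppz tz; lia.
have LI l : (l \notin I) = (l \in leaves T) by rewrite inE negbK.
have PI : P \subset I by apply/subsetP => _ /imsetP[l _ ->].
have rP : r \in P.
  apply/imsetP; exists l0 => //.
  have l0r : l0 != r by apply: contraNneq rI => <-.
  have := l0L; rewrite inE => /cards1P[z Nz].
  have /setP/(_ r) := Nz; rewrite !inE el0r => /esym/eqP ->.
  by have /setP/(_ (pa l0)) := Nz; rewrite !inE edge_sym epa // => /esym/eqP.
have cP : #|leaves T| <= delta * #|P|.
  have sub : leaves T \subset \bigcup_(p in P) [set t | pa t == p].
    apply/subsetP => l lL; apply/bigcupP; exists (pa l); last by rewrite inE.
    exact: imset_f.
  apply: leq_trans (subset_leq_card sub) _; apply: leq_trans (leq_card_bigcup _ _) _.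
  apply: leq_trans (leq_sum _ (E2 := fun=> delta) _) _ => [p _|]; first exact: card_pa.
  by rewrite sum_nat_const mulnC.
have d3 : delta <= delta ^ 3 by rewrite -{1}(expn1 delta) leq_pexp2l.
have d34 : delta ^ 3 <= delta ^ 4 by rewrite leq_pexp2l.
have Pbig : 32 * delta ^ 3 * M <= #|P|.
  rewrite -(leq_pmul2l d0); apply: leq_trans cP; apply: leq_trans big.
  by rewrite (expnS delta 3); move: (delta ^ 3) => c; clear; lia.
(* The leaves provide the slack: the terms other than [#|I|] add up to at most
   [7 M + 19 delta^3 M]. *)
have budget : #|X| + #|I| + (m.*2 + M).*2 + (delta + 8 * delta ^ 3).*2.+1 * m <= #|G|.
  have leI : #|I| + #|leaves T| = #|G| by rewrite -cTG -(cardsC (leaves T)) addnC.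
  have : (delta + 8 * delta ^ 3).*2.+1 * m <= (delta + 8 * delta ^ 3).*2.+1 * M.
    by rewrite leq_mul2l mM orbT.
  have : (delta + 8 * delta ^ 3).*2.+1 * M <= 19 * delta ^ 3 * M.
    rewrite leq_mul2r; apply/orP; right; lia.
  have : 7 * M + 19 * delta ^ 3 * M <= 32 * delta ^ 4 * M.
    rewrite -mulnDl leq_mul2r; apply/orP; right; lia.
  move: big mM XM leI; clear.
  move: (delta ^ 4) (delta ^ 3) (delta + _).*2.+1 => a b c; lia.
have B1 : 1 < 8 * delta ^ 3 by lia.
have [g g_inj gE] := @spanning_embedding _ (@edge G) X m (delta + 8 * delta ^ 3)
  (8 * delta ^ 3) (@edge_sym G) jG m0 T r pa dep delta pa_r dep_r dep_pa card_pa
  card_tadj B1 (leqnn _) I P (fun t _ => paI t) PI M mM XM budget (leqnn _) Pbig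
  (fun l lI => imset_f pa (etrans (esym (LI l)) lI)) rP
  (fun p pP => let: ex_intro2 l lL e := imsetP pP in ex_intro2 _ _ l (etrans (LI l) lL) (esym e))
  cTG ext0 expX.
exists g; split=> // x y /eadj/orP[] /andP[nr /eqP->]; last exact: gE.
by rewrite edge_sym; apply: gE.
Qed.

(** * Balanced colourings by the local lemma *)

Section LocalLemma.
Variables (Omega V : finType) (A : V -> {set Omega}) (Gam : V -> {set V}) (N c : nat).

(** [Omega] carries the uniform measure, so probabilities are ratios of cardinals. The sets [A v]
    are the bad events and [Gam v] indexes those on which [A v] may depend. *)
Definition avoid (S : {set V}) := [set w | [forall u in S, w \notin A u]].

Lemma avoidU1 u S : avoid (u |: S) = avoid S :\: A u.
Proof.
apply/setP => w; rewrite !inE; apply/forall_inP/andP => [h|[nA /forall_inP h] x].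
  split; first by apply: h; apply: setU11.
  by apply/forall_inP => x xS; apply: h; apply: setU1r.
by case/setU1P=> [->|/h].
Qed.

Lemma avoidS (S S' : {set V}) : S \subset S' -> avoid S' \subset avoid S.
Proof.
move/subsetP=> sS; apply/subsetP => w; rewrite !inE => /forall_inP h.
by apply/forall_inP => x /sS/h.
Qed.

Hypotheses (cardG : forall v, #|Gam v| <= c) (cN : 4 * c <= N) (c_gt0 : 0 < c).
Hypothesis indep : forall v (S : {set V}), [disjoint S & Gam v] ->
  N * #|A v :&: avoid S| <= #|avoid S|.

(** Induction on the size of [S]. Given the events of [S] outside [Gam v], the event [A v] has
    probability at most [1/N]. The at most [c] remaining events have conditional probability at most
    [2/N] each, so avoiding them too keeps at least half of the space, as [4 c <= N]. *)
Lemma lll_step v (S : {set V}) : N * #|A v :&: avoid S| <= 2 * #|avoid S|.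
Proof.
move: {2}#|S| (leqnn #|S|) => n; elim: n v S => [|n IH] v S le_n.
  have S0 : S = set0 by apply/eqP; rewrite -cards_eq0 -leqn0.
  have := @indep v S; rewrite S0 disjoints_subset sub0set => /(_ isT).
  by move/leq_trans; apply; rewrite leq_pmull.
pose S1 := S :&: Gam v; pose S2 := S :\: Gam v.
have ind2 : N * #|A v :&: avoid S2| <= #|avoid S2|.
  by apply: indep; rewrite -setI_eq0 /S2 setIDAC setDIl setDv setI0.
have le2 : #|A v :&: avoid S| <= #|A v :&: avoid S2|.
  by apply/subset_leq_card/setIS/avoidS/subsetDl.
case: (set_0Vmem S1) => [S10|[u0 u0S1]].
  have S2S : S2 = S.
    by apply/setDidPl; rewrite -setI_eq0 -/S1 S10.
  by rewrite S2S in ind2; apply: leq_trans ind2 _; rewrite leq_pmull.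
have ltS2 : #|S2| <= n.
  rewrite -ltnS; apply: leq_trans le_n; rewrite -(cardsID (Gam v) S) -/S1 -/S2.
  by rewrite -[X in X < _]add0n ltn_add2r; apply/card_gt0P; exists u0.
have split_avoid : #|avoid S2| <= #|avoid S| + \sum_(u in S1) #|A u :&: avoid S2|.
  have sub : avoid S2 \subset avoid S :|: \bigcup_(u in S1) (A u :&: avoid S2).
    apply/subsetP => w wS2; rewrite in_setU.
    case: (boolP (w \in avoid S)) => //=; rewrite inE => /forall_inPn[u uS].
    rewrite negbK => wA; apply/bigcupP; exists u; last by rewrite inE wA wS2.
    rewrite inE uS; apply: contraTT wA => uG; have := wS2; rewrite inE => /forall_inP; apply.
    by rewrite inE uG uS.
  apply: leq_trans (subset_leq_card sub) _; apply: leq_trans (leq_card_setU _ _) _.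
  by rewrite leq_add2l leq_card_bigcup.
have sumN : N * \sum_(u in S1) #|A u :&: avoid S2| <= c * (2 * #|avoid S2|).
  rewrite big_distrr /=.
  apply: leq_trans (leq_sum _ (E2 := fun=> 2 * #|avoid S2|) _) _ => [u _|].
    exact: IH.
  rewrite sum_nat_const leq_mul2r; apply/orP; right; apply: leq_trans (cardG v).
  by apply/subset_leq_card/subsetIr.
have N_gt0 : 0 < N by apply: leq_trans cN; rewrite muln_gt0.
have half : 2 * \sum_(u in S1) #|A u :&: avoid S2| <= #|avoid S2|.
  rewrite -(leq_pmul2l N_gt0).
  have : 4 * c * #|avoid S2| <= N * #|avoid S2| by rewrite leq_mul2r cN orbT.
  by move: sumN; clear; move: (\sum_(_ in _) _) #|_| => a b; lia.
have : N * #|A v :&: avoid S| <= N * #|A v :&: avoid S2| by rewrite leq_mul2l le2 orbT.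
by move: ind2 half split_avoid; clear; move: (\sum_(_ in _) _); lia.
Qed.

Lemma local_lemma : 0 < #|Omega| -> 0 < #|avoid setT|.
Proof.
move=> Om; have N3 : 2 < N by apply: leq_trans cN; move: c_gt0; clear; lia.
suff : forall n (S : {set V}), #|S| <= n -> 0 < #|avoid S| by move=> /(_ _ _ (leqnn _)).
elim=> [|n IH] S le_n.
  have -> : S = set0 by apply/eqP; rewrite -cards_eq0 -leqn0.
  have /card_gt0P[w _] := Om; apply/card_gt0P; exists w; rewrite inE.
  by apply/forall_inP => x; rewrite inE.
case: (set_0Vmem S) => [S0|[u uS]]; first by apply: IH; rewrite S0 cards0.
have := IH (S :\ u); rewrite (cardsD1 u S) uS in le_n => /(_ le_n) pos.
have := lll_step u (S :\ u); rewrite setIC; have := cardsID (A u) (avoid (S :\ u)).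
rewrite -avoidU1 setD1K //; move: pos N3; clear.
by move: #|avoid (S :\ u)| #|_| #|avoid S| => a b x; nia.
Qed.
End LocalLemma.

Lemma bernoulli_exp y n : y ^ n.+1 + n.+1 * y ^ n <= y.+1 ^ n.+1.
Proof.
elim: n => [|n IH]; first by rewrite !expn1 expn0; lia.
rewrite [y.+1 ^ n.+2]expnS; apply: leq_trans (leq_mul (leqnn y.+1) IH).
by rewrite [y ^ n.+2]expnS [y ^ n.+1]expnS; move: (y ^ n); nia.
Qed.

(** The integer form of [(1 - 1/x)^x <= 1/2], from the first two terms of a binomial expansion. *)
Lemma double_exp_pred x : 0 < x -> 2 * x.-1 ^ x <= x ^ x.
Proof.
case: x => // y _ /=; apply: leq_trans (bernoulli_exp y y).
by rewrite mul2n -addnn leq_add2l expnS leq_mul2r leqnSn orbT.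
Qed.

(** * Uniform random colourings *)

Section Colouring.
Variables (V : finType) (k : nat).
Local Notation Omega := {ffun V -> 'I_k}.

Definition recolour (c : Omega) (x : V) (a : 'I_k) : Omega :=
  [ffun v => if v == x then a else c v].

(** Exchanging the new colour with the old colour of [x] is an involution on pairs of a colouring in
    [W] and a colour. In probabilistic terms, given [W] the colour of [x] is uniform and independent
    of the other colours. *)
Lemma recolour_avg (W : {set Omega}) (x : V) (phi : Omega -> nat) :
    (forall c a, c \in W -> recolour c x a \in W) ->
  k * \sum_(c in W) phi c = \sum_(c in W) \sum_a phi (recolour c x a).
Proof.
move=> invW; rewrite (pair_big (mem W) predT) /=.
pose sw (p : Omega * 'I_k) := (recolour p.1 x p.2, p.1 x).
have swK : involutive sw.
  case=> c a; congr pair; last by rewrite /= ffunE eqxx.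
  by apply/ffunP => v; rewrite !ffunE; case: eqP => [->|].
transitivity (\sum_(p : Omega * 'I_k | (p.1 \in W) && predT p.2) phi p.1).
  rewrite -(pair_big (mem W) predT (fun c _ => phi c)) /= big_distrr /=.
  by apply: eq_bigr => c _; rewrite sum_nat_const card_ord.
rewrite [RHS](reindex_inj (inv_inj swK)) /=; apply: eq_big => [[c a]|[c a] _] /=.
  rewrite !andbT; apply/idP/idP; first exact: invW.
  move/(invW _ (c x)); rewrite (_ : recolour _ _ _ = c) //.
  by apply/ffunP => v; rewrite !ffunE; case: eqP => [->|].
by congr phi; apply/ffunP => v; rewrite !ffunE; case: eqP => [->|].
Qed.

(** Given [W], the colours on [s] are independent and uniform, so the expectation of the product
    factorises. *)
Lemma recolour_moment (W : {set Omega}) (g : 'I_k -> nat) (s : seq V) : uniq s ->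
    (forall x c a, x \in s -> c \in W -> recolour c x a \in W) ->
  k ^ size s * \sum_(c in W) \prod_(x <- s) g (c x) = #|W| * (\sum_a g a) ^ size s.
Proof.
elim: s => [|x s IH] /=.
  by move=> _ _; under eq_bigr do rewrite big_nil; rewrite sum1_card mul1n muln1.
case/andP=> xs unq invW; rewrite expnSr -mulnA (@recolour_avg W x); last first.
  by move=> c a; apply: invW; apply: mem_head.
have -> : \sum_(c in W) \sum_a \prod_(y <- x :: s) g (recolour c x a y) =
    \sum_(c in W) (\sum_a g a) * \prod_(y <- s) g (c y).
  apply: eq_bigr => c _; rewrite big_distrl; apply: eq_bigr => a _ /=.
  rewrite big_cons ffunE eqxx; congr (_ * _); rewrite big_seq [RHS]big_seq.
  apply: eq_bigr => y ys; rewrite ffunE; case: eqP => // yx.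
  by rewrite yx (negbTE xs) in ys.
rewrite -big_distrr /= mulnCA IH //; first by rewrite expnS mulnCA.
by move=> y c a ys; apply: invW; rewrite inE ys orbT.
Qed.

(* Markov's inequality for 2^(number of vertices of s not coloured i). *)
Lemma rare_colour (W : {set Omega}) (i : 'I_k) (s : seq V) t : uniq s ->
    (forall x c a, x \in s -> c \in W -> recolour c x a \in W) -> 4 * k * t <= size s ->
  2 ^ t * #|[set c in W | count (fun x => c x == i) s < t]| <= #|W|.
Proof.
move=> unq invW szs; set Z := [set c in W | _].
have k_gt0 : 0 < k by apply: leq_ltn_trans (ltn_ord i).
pose g (a : 'I_k) := if a == i then 1 else 2.
have sumg : \sum_a g a = (2 * k).-1.
  rewrite (bigD1 i) //= {1}/g eqxx (eq_bigr (fun=> 2)) => [|a /negbTE ai]; last by rewrite /g ai.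
  rewrite sum_nat_const (_ : #|_| = k.-1); first by lia.
  by transitivity #|predC1 i|; [apply: eq_card|rewrite cardC1 card_ord].
have prodg c : \prod_(x <- s) g (c x) = 2 ^ (size s - count (fun x => c x == i) s).
  rewrite -(count_predC (fun x => c x == i) s) addKn.
  elim: (s) => [|x s' IH]; first by rewrite big_nil.
  by rewrite big_cons IH /= /g; case: (c x == i); rewrite /= ?mul1n // add1n expnS.
have mom := recolour_moment g unq invW; rewrite sumg in mom.
have lb : k ^ size s * (#|Z| * 2 ^ (size s - t)) <= #|W| * (2 * k).-1 ^ size s.
  rewrite -mom leq_mul2l; apply/orP; right; rewrite -sum_nat_const.
  rewrite [X in _ <= X](big_setID Z) /=; apply: leq_trans (leq_addr _ _).
  rewrite (setIidPr _); last by apply/subsetP => c; rewrite inE => /andP[].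
  apply: leq_sum => c; rewrite inE => /andP[_ lt_t]; rewrite prodg leq_exp2l //.
  exact: leq_sub2l (ltnW lt_t).
have szt : t <= size s by apply: leq_trans szs; rewrite leq_pmull // muln_gt0.
have lb2 : (2 * k) ^ size s * #|Z| <= 2 ^ t * (#|W| * (2 * k).-1 ^ size s).
  rewrite expnMn; have -> : 2 ^ size s = 2 ^ t * 2 ^ (size s - t) by rewrite -expnD subnKC.
  apply: leq_trans (leq_mul (leqnn (2 ^ t)) lb).
  by apply: eq_leq; move: (2 ^ t) (2 ^ _) (k ^ _) => a b x; lia.
(* By [double_exp_pred], [(1 - 1/(2k))^(4k) <= 1/4], and [s] has room for [t] blocks of length [4k].
   The gain [4^t] outweighs the loss [2^t] in Markov's inequality. *)
have dbl : 4 ^ t * (2 * k).-1 ^ size s <= (2 * k) ^ size s.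
  have -> : size s = 4 * k * t + (size s - 4 * k * t) by rewrite subnKC.
  rewrite !expnD mulnA; apply: leq_mul; last first.
    by case: (size s - _) => // j; rewrite leq_exp2r // leq_pred.
  have step : 4 * (2 * k).-1 ^ (4 * k) <= (2 * k) ^ (4 * k).
    have -> : 4 * k = 2 * k * 2 by lia.
    rewrite 2!(expnM _ (2 * k) 2); have -> : 4 = 2 ^ 2 by [].
    by rewrite -expnMn leq_exp2r // double_exp_pred // muln_gt0.
  by rewrite 2!(expnM _ (4 * k) t) -expnMn; case: (t) => // j; rewrite leq_exp2r.
have pos : 0 < 2 ^ t * (2 * k).-1 ^ size s.
  by rewrite muln_gt0 !expn_gt0 /=; apply/orP; left; lia.
rewrite -(leq_pmul2l pos).
have e4 : 4 ^ t = 2 ^ t * 2 ^ t by rewrite -expnMn.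
have := leq_mul dbl (leqnn #|Z|) => /leq_trans /(_ lb2); rewrite e4.
by move: (2 ^ t) (_ ^ size s) => a b; clear; lia.
Qed.
End Colouring.

(** The bad event at [v] is that some colour occurs fewer than [t] times around it. By [rare_colour]
    and a union over the colours, its probability is at most [k / 2^t], hence at most [1 / (4 d^2)].
    Recolouring a neighbour of [v] affects only events at vertices sharing a neighbour with [v], of
    which there are at most [d ^ 2]. *)
Lemma balanced_colouring (V : finType) (e : rel V) (d k : nat) : symmetric e ->
    0 < d -> 0 < k -> (forall v, #|[set w | e v w]| = d) ->
    4 * d ^ 2 * k <= 2 ^ (d %/ (4 * k)) ->
  exists c : V -> 'I_k, forall v i, d %/ (4 * k) <= #|[set w | e v w && (c w == i)]|.
Proof.
move=> sym d0 k0 reg big; set t := d %/ (4 * k) in big *.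
pose Omega := {ffun V -> 'I_k}.
pose A v := [set c : Omega | [exists i, #|[set w | e v w && (c w == i)]| < t]].
pose Gam v := \bigcup_(w in [set w | e v w]) [set u | e w u].
have cG v : #|Gam v| <= d ^ 2.
  apply: leq_trans (leq_card_bigcup _ _) _.
  apply: leq_trans (leq_sum _ (E2 := fun=> d) _) _ => [w _|]; first by rewrite reg.
  by rewrite sum_nat_const reg.
have indep v (S : {set V}) : [disjoint S & Gam v] ->
    4 * d ^ 2 * #|A v :&: avoid A S| <= #|avoid A S|.
  move=> dis; set W := avoid A S; pose s := enum [set w | e v w].
  have invW x c a : x \in s -> c \in W -> recolour c x a \in W.
    rewrite mem_enum inE => evx; rewrite !inE => /forall_inP h; apply/forall_inP => u uS.
    have nux : ~~ e u x.
      apply: contraL (uS) => eux; rewrite (disjointFl dis) //.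
      by apply/bigcupP; exists x; rewrite inE // sym.
    move: (h u uS); rewrite !inE; congr (~~ _); apply: eq_existsb => i; congr (_ < t).
    apply: eq_card => w; rewrite !inE ffunE; case: (eqVneq w x) => // ->.
    by rewrite (negbTE nux).
  have cnt (c : Omega) i : #|[set w | e v w && (c w == i)]| = count (fun x => c x == i) s.
    rewrite -size_filter cardE; apply/perm_size/uniq_perm.
    - exact: enum_uniq.
    - by apply: filter_uniq; apply: enum_uniq.
    by move=> w; rewrite mem_filter !mem_enum !inE andbC.
  have szs : 4 * k * t <= size s by rewrite -cardE reg mulnC leq_trunc_div.
  have sub : A v :&: W \subset \bigcup_(i in 'I_k)
      [set c in W | count (fun x => c x == i) s < t].
    apply/subsetP => c /setIP[]; rewrite inE => /existsP[i lt_i] cW.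
    by apply/bigcupP; exists i; rewrite // inE cW -cnt.
  have le1 := leq_trans (subset_leq_card sub) (leq_card_bigcup _ _).
  have : 2 ^ t * #|A v :&: W| <= k * #|W|.
    apply: leq_trans (leq_mul (leqnn _) le1) _; rewrite big_distrr /=.
    apply: leq_trans (leq_sum _ (E2 := fun=> #|W|) _) _ => [i _|].
      by apply: rare_colour; rewrite ?enum_uniq.
    by rewrite sum_nat_const card_ord.
  have : 4 * d ^ 2 * k * #|A v :&: W| <= 2 ^ t * #|A v :&: W| by rewrite leq_mul2r big orbT.
  move=> /leq_trans h /h; rewrite mulnAC [X in X <= _]mulnC leq_pmul2l //.
have /card_gt0P[c] : 0 < #|avoid A setT|.
  apply: (local_lemma cG _ _ indep); rewrite ?expn_gt0 ?d0 //.
  by apply/card_gt0P; exists [ffun=> Ordinal k0].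
rewrite inE => /forall_inP h; exists c => v i; rewrite leqNgt; apply/negP => lt_i.
by have := h v (in_setT v); rewrite inE => /existsP[]; exists i.
Qed.

Lemma cube_le_exp t : 11 <= t -> t.+1 ^ 3 <= 2 ^ t.
Proof.
move=> /subnK <-; elim: (t - 11) => [|j IH]; first by rewrite add0n; lia.
rewrite addSn [2 ^ _]expnS; apply: leq_trans (leq_mul (leqnn 2) IH).
by rewrite !expnS expn0; nia.
Qed.

(** With [t] the quotient, [d < 4k(t+1)] bounds the left side by [64 k^3 (t+1)^2], hence by
    [(t+1)^3]. *)
Lemma colouring_threshold k d : 0 < k -> 4 * k * (64 * k ^ 3 + 12) <= d ->
  4 * d ^ 2 * k <= 2 ^ (d %/ (4 * k)).
Proof.
move=> k0 dbig; set t := d %/ (4 * k).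
have k4 : 0 < 4 * k by rewrite muln_gt0.
have tbig : 64 * k ^ 3 + 12 <= t by rewrite leq_divRL // mulnC.
have dt : d < t.+1 * (4 * k) by rewrite ltn_ceil.
apply: leq_trans (cube_le_exp (_ : 11 <= t)); last by lia.
have d2 : d ^ 2 <= (t.+1 * (4 * k)) ^ 2 by rewrite leq_exp2r // ltnW.
apply: (@leq_trans (4 * (t.+1 * (4 * k)) ^ 2 * k)).
  by rewrite leq_mul2r leq_mul2l d2 !orbT.
have -> : 4 * (t.+1 * (4 * k)) ^ 2 * k = 64 * k ^ 3 * t.+1 ^ 2.
  by rewrite expnMn (expnS k 2) expnMn; move: (t.+1 ^ 2) (k ^ 2) => a b; lia.
rewrite [t.+1 ^ 3]expnS leq_mul2r; apply/orP; right; lia.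
Qed.

(** * The expander mixing lemma *)

Local Open Scope ring_scope.

Section Spectral.
Local Open Scope sesquilinear_scope.

Lemma char_poly_similar (F : fieldType) n (P D : 'M[F]_n) : P \in unitmx ->
  char_poly (invmx P *m D *m P) = char_poly D.
Proof.
move=> uP; rewrite /char_poly; pose f := map_mx (@polyC F) : 'M[F]_n -> 'M_n.
have -> : char_poly_mx (invmx P *m D *m P) = f (invmx P) *m char_poly_mx D *m f P.
  rewrite /char_poly_mx /f mulmxBr mulmxBl; congr (_ - _); last by rewrite !map_mxM.
  by rewrite scalar_mxC -mulmxA -map_mxM mulVmx // map_mx1 mulmx1.
rewrite /f !det_mulmx mulrAC -det_mulmx -map_mxM mulVmx // map_mx1 det1.
by rewrite mul1r.
Qed.

Lemma dotmx_unitary (C : numClosedFieldType) n (P : 'M[C]_n) (x y : 'rV_n) :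
  P \is unitarymx -> dotmx (x *m P^t*) (y *m P^t*) = dotmx x y.
Proof.
move=> uP; rewrite !dotmxE trmx_mul map_mxM /= -mulmxA [P^t* *m _]mulmxA.
have := uP; rewrite -trmxC_unitary => /unitarymxP ->.
by rewrite mul1mx.
Qed.

Lemma dotmx_sum (C : numClosedFieldType) n (x y : 'rV[C]_n) :
  dotmx x y = \sum_i x 0 i * (y 0 i)^*.
Proof. by rewrite dotmxE mxE; apply: eq_bigr => i _; rewrite !mxE. Qed.

(* An eigenvector for an eigenvalue outside [s] spans the only eigenspace that
   is not controlled by [lambda]. *)
Lemma normal_gap_bound (C : numClosedFieldType) n (A : 'M[C]_n) (s0 d lambda : C)
    (s : seq C) (j x y : 'rV[C]_n) :
    A \is normalmx -> char_poly A = \prod_(z <- s0 :: s) ('X - z%:P) ->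
    (forall z, z \in s -> `|z| <= lambda) -> lambda < `|d| -> 0 <= lambda ->
    j != 0 -> j *m A = d *: j -> dotmx x j = 0 ->
  `|dotmx (x *m A) y| ^+ 2 <= lambda ^+ 2 * dotmx x x * dotmx y y.
Proof.
move=> nA chA gap dgap l0 jn0 jA xj.
pose P := spectralmx A; pose sp := spectral_diag A.
have uP : P \is unitarymx by apply: spectral_unitarymx.
have Pu : P \in unitmx by apply: spectral_unit.
have defA : A = invmx P *m diag_mx sp *m P by apply/orthomx_spectralP.
have iP := invmx_unitary uP.
(* [tr u] lists the coordinates of [u] in an orthonormal eigenbasis. *)
pose tr (u : 'rV[C]_n) := u *m P^t*.
have trA u : tr (u *m A) = tr u *m diag_mx sp.
  by rewrite /tr defA iP !mulmxA mulmxtVK.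
have trE u i : tr (u *m A) 0 i = sp 0 i * tr u 0 i.
  by rewrite trA mul_mx_diag mxE mulrC.
have perm_sp : perm_eq [seq sp 0 i | i <- enum 'I_n] (s0 :: s).
  apply: prod_XsubC_eq; rewrite -chA defA char_poly_similar // char_poly_trig; last first.
    exact/diag_mx_is_trig.
  rewrite big_map big_enum; apply: eq_bigr => i _.
  by rewrite !mxE eqxx mulr1n.
have trj i : tr j 0 i != 0 -> sp 0 i = d.
  move=> ji; have := trE j i; rewrite jA /tr -scalemxAl mxE -/(tr j) => /(mulIf ji).
  by [].
have tr0 : tr j != 0.
  apply: contraNneq jn0 => j0.
  have : tr j *m P = j by rewrite /tr -iP mulmxKV.
  by rewrite j0 mul0mx => <-.
have [i0 ji0] : exists i, tr j 0 i != 0.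
  by apply/rV0Pn.
have ds : d \notin s.
  by apply/negP => /gap; rewrite (lt_geF dgap).
have sp_mem i : sp 0 i \in s0 :: s.
  by rewrite -(perm_mem perm_sp); apply: map_f; rewrite mem_enum.
(* A nonzero coordinate of [j] belongs to the eigenvalue [d], which is too large to lie in [s]. So
   [d] is a simple eigenvalue, found only at the position [i0]. *)
have s0d : s0 = d.
  by have := sp_mem i0; rewrite trj // inE (negbTE ds) orbF => /eqP.
have sp_le i : i != i0 -> `|sp 0 i| <= lambda.
  move=> ii0; have := sp_mem i; rewrite inE => /orP[/eqP spi|/gap//].
  have := perm_sp => /permP/(_ (pred1 d)) /=; rewrite s0d eqxx (count_memPn ds) addn0.
  rewrite count_map -size_filter => sz1.
  have mem_i k : sp 0 k = d -> k \in [seq i <- enum 'I_n | preim (fun i => sp 0 i) (pred1 d) i].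
    by move=> spk; rewrite mem_filter /= spk eqxx mem_enum.
  move: sz1 (mem_i i) (mem_i i0); case: [seq _ <- _ | _] => [|k [|k' l]] // _.
  rewrite !inE spi s0d trj // => /(_ erefl)/eqP ik /(_ erefl)/eqP i0k.
  by rewrite ik i0k eqxx in ii0.
have trj0 i : i != i0 -> tr j 0 i = 0.
  move=> ii0; apply/eqP; apply: contraT => /trj spd.
  by have := sp_le i ii0; rewrite spd (lt_geF dgap).
have trx0 : tr x 0 i0 = 0.
  have := xj; rewrite -(dotmx_unitary x j uP) dotmx_sum (bigD1 i0) //= big1 ?addr0.
    by move/eqP; rewrite mulf_eq0 conjC_eq0 -/(tr j) (negbTE ji0) orbF => /eqP.
  by move=> i ii0; rewrite -/(tr j) trj0 // conjC0 mulr0.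
(* After Cauchy-Schwarz it remains to bound the norm of [x *m A], which is done coordinatewise
   because [x] has no component at [i0]. *)
have cs : `|dotmx (x *m A) y| ^+ 2 <= dotmx (x *m A) (x *m A) * dotmx y y.
  exact: (CauchySchwarz (@dotmx C n) (x *m A) y).1.
apply: le_trans cs _; apply: ler_wpM2r.
  by rewrite dotmx_sum sumr_ge0 // => i _; rewrite mul_conjC_ge0.
rewrite -(dotmx_unitary (x *m A) (x *m A) uP) -(dotmx_unitary x x uP) !dotmx_sum.
rewrite mulr_sumr; apply: ler_sum => i _; rewrite -!normCK -/(tr _) -/(tr x) trE normrM.
rewrite exprMn; case: (eqVneq i i0) => [->|ii0]; first by rewrite trx0 normr0 expr0n !mulr0.
apply: ler_wpM2r; first exact: exprn_ge0.
by rewrite lerXn2r ?nnegrE // sp_le.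
Qed.
End Spectral.

(** Ordered pairs are counted, so an edge inside [A :&: B] counts twice. *)
Definition edges_between (G : sgraph) (A B : {set G}) : nat :=
  (\sum_(x in A) \sum_(y in B) edge x y)%N.

Section Mixing.
Variables (R : realType) (G : sgraph).
Local Notation n := #|G|.
Local Notation C := R[i].
Local Notation toC := (real_complex R).
Local Open Scope sesquilinear_scope.

Definition indicator (A : {set G}) : 'rV[C]_n := \row_i (enum_val i \in A)%:R.

Lemma sum_enum_val (F : G -> C) : \sum_(i < n) F (enum_val i) = \sum_v F v.
Proof. by rewrite -(big_enum_val (A := G)). Qed.

Lemma dot_indicator (A B : {set G}) :
  dotmx (indicator A) (indicator B) = #|A :&: B|%:R.
Proof.
rewrite dotmx_sum -sum1_card natr_sum [RHS]big_mkcond /= -sum_enum_val; apply: eq_bigr => i _.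
by rewrite !mxE conjC_nat inE; do 2!case: (_ \in _); rewrite /= ?mulr1 ?mulr0.
Qed.

Let A := map_mx toC (adjacency R G).

Lemma adjacencyC_entry i j : A i j = (edge (enum_val i) (enum_val j))%:R.
Proof. by rewrite !mxE rmorph_nat. Qed.

Lemma dot_adjacency (S T : {set G}) :
  dotmx (indicator S *m A) (indicator T) = (edges_between S T)%:R.
Proof.
rewrite dotmx_sum /edges_between exchange_big /= natr_sum [RHS]big_mkcond /= -sum_enum_val.
apply: eq_bigr => k _; rewrite !mxE conjC_nat; case: (_ \in T); last by rewrite mulr0.
rewrite mulr1 natr_sum [RHS]big_mkcond /= -sum_enum_val; apply: eq_bigr => i _.
by rewrite adjacencyC_entry mxE; case: (_ \in S); rewrite ?mul1r ?mul0r.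
Qed.

Lemma adjacencyC_normal : A \is normalmx.
Proof.
suff sA : A^t* = A by apply/normalmxP; rewrite sA.
by apply/matrixP => i k; rewrite !mxE !rmorph_nat edge_sym.
Qed.

Lemma adjacencyC_regular d : regular d G ->
  indicator setT *m A = d%:R *: indicator setT.
Proof.
move=> reg; apply/rowP => k; rewrite !mxE inE mulr1 -(reg (enum_val k)) /degree -sum1_card.
rewrite natr_sum [RHS]big_mkcond /= -sum_enum_val; apply: eq_bigr => i _.
by rewrite adjacencyC_entry !mxE !inE mul1r edge_sym; case: (edge _ _).
Qed.

(** Subtracting its mean makes the indicator of [S] a vector [x] orthogonal to the constant vector
    [j]. The form [dotmx (x *m A) (indicator T)] is then the deviation to be bounded, and the
    squared norm of [x] is at most [#|S|], so [normal_gap_bound] applies over the complex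
    numbers. *)
Lemma expander_mixing d (lambda : R) (S T : {set G}) :
    ndlambda_graph n d lambda G -> 0 <= lambda -> lambda < d%:R -> (0 < n)%N ->
  ((edges_between S T)%:R - d%:R * #|S|%:R * #|T|%:R / n%:R) ^+ 2 <=
    lambda ^+ 2 * #|S|%:R * #|T|%:R.
Proof.
case=> _ reg [[|s0 s] [[_ chA] gap]] l0 ld n0.
  have := size_char_poly (adjacency R G); rewrite chA big_nil size_poly1.
  by move: n0; case: #|G|.
have nn0 : n%:R != 0 :> C by rewrite pnatr_eq0 -lt0n.
pose j := indicator setT; pose c : C := #|S|%:R / n%:R.
pose x := indicator S - c *: j.
have dotx y : dotmx x y = dotmx (indicator S) y - c * dotmx j y.
  by rewrite !dotmxE mulmxBl -scalemxAl mxE [X in _ + X]mxE [X in _ - X]mxE.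
have xj : dotmx x j = 0.
  by rewrite dotx !dot_indicator setIT setIid cardsT /c divfK // subrr.
have xx : dotmx x x = #|S|%:R - c * #|S|%:R.
  have -> : #|S|%:R - c * #|S|%:R = dotmx x (indicator S) - c * dotmx x j.
    by rewrite xj mulr0 subr0 dotx !dot_indicator setIid setTI.
  rewrite !dotmx_sum mulr_sumr -sumrB; apply: eq_bigr => i _.
  have -> : (x 0 i)^* = (indicator S 0 i)^* - c * (j 0 i)^*.
    by rewrite !mxE rmorphB rmorphM /= /c fmorph_div !rmorph_nat.
  by rewrite mulrBr mulrCA.
have j0 : j != 0.
  have i0 : 'I_n by exact: Ordinal n0.
  by apply/eqP => /rowP/(_ i0); rewrite !mxE inE => /eqP; rewrite oner_eq0.
have c0 : 0 <= c by rewrite divr_ge0 ?ler0n.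
have chAC : char_poly A = \prod_(z <- toC s0 :: map toC s) ('X - z%:P).
  rewrite -map_char_poly chA rmorph_prod /= -map_cons big_map; apply: eq_bigr => z _.
  by rewrite map_polyXsubC.
have normC z : `|toC z| = toC `|z|.
  by rewrite normc_def /= expr0n addr0 sqrtr_sqr.
have gapC z : z \in map toC s -> `|z| <= toC lambda.
  by case/mapP => w ws ->; rewrite normC lecR gap.
have dgap : toC lambda < `|d%:R|.
  by rewrite normr_nat -(rmorph_nat toC) ltcR.
have l0C : 0 <= toC lambda by rewrite -(rmorph0 toC) lecR.
have := normal_gap_bound (indicator T) adjacencyC_normal chAC gapC dgap l0C j0
  (adjacencyC_regular reg) xj.
have -> : dotmx (x *m A) (indicator T) =
    toC ((edges_between S T)%:R - d%:R * #|S|%:R * #|T|%:R / n%:R).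
  rewrite mulmxBl -scalemxAl (adjacencyC_regular reg) scalerA dotmxE mulmxBl -scalemxAl.
  rewrite mxE [X in _ + X]mxE [X in _ - X]mxE -!dotmxE dot_adjacency dot_indicator setTI.
  rewrite rmorphB /= fmorph_div !rmorphM /= !rmorph_nat; congr (_ - _).
  by rewrite /c; rewrite mulrAC [_ * d%:R]mulrC mulrAC -!mulrA [_ * (#|T|%:R * _)]mulrCA.
rewrite normC -rmorphXn real_normK ?num_real // dot_indicator setIid => bound.
rewrite -lecR; apply: le_trans bound _; rewrite 2!rmorphM rmorphXn /= !rmorph_nat.
apply: ler_wpM2r; first exact: ler0n.
apply: ler_wpM2l; first exact: exprn_ge0.
by rewrite xx gerBl mulr_ge0 ?ler0n.
Qed.
End Mixing.

(** * Pseudorandom graphs *)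

Section Pseudorandom.
Variables (R : realType) (G : sgraph) (d : nat) (lambda : R).
Local Notation n := #|G|.
Hypotheses (l_gt0 : 0 < lambda) (n_gt0 : (0 < n)%N).
Hypothesis mixing : forall S T : {set G},
  ((edges_between S T)%:R - d%:R * #|S|%:R * #|T|%:R / n%:R) ^+ 2 <=
    lambda ^+ 2 * #|S|%:R * #|T|%:R.

(** With no edge between [A] and [B], mixing gives [d^2 #|A| #|B| <= lambda^2 n^2], although both
    sets have at least [m] elements. *)
Lemma mixing_joined m : (0 < m)%N -> lambda * n%:R < d%:R * m%:R ->
  joined (@edge G) m.
Proof.
move=> m0 big A B mA mB.
have [/existsP[x /existsP[y /and3P[xA yB exy]]]|no] :=
  boolP [exists x, exists y, [&& x \in A, y \in B & edge x y]]; first by exists x, y.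
have e0 : edges_between A B = 0%N.
  apply: big1 => x xA; apply: big1 => y yB; apply/eqP; rewrite eqb0.
  apply: contra no => exy; apply/existsP; exists x; apply/existsP; exists y.
  by rewrite xA yB.
have := mixing A B; rewrite e0 sub0r sqrrN.
set a := #|A|%:R; set b := #|B|%:R => bound; exfalso.
have N0 : 0 < n%:R :> R by rewrite ltr0n.
have m0R : 0 < m%:R :> R by rewrite ltr0n.
have am : m%:R <= a by rewrite ler_nat.
have bm : m%:R <= b by rewrite ler_nat.
have a0 : 0 < a by apply: lt_le_trans am.
have b0 : 0 < b by apply: lt_le_trans bm.
have bound' : d%:R ^+ 2 * (a * b) <= (lambda * n%:R) ^+ 2.
  rewrite -(ler_pM2r (mulr_gt0 a0 b0)).
  have -> : d%:R ^+ 2 * (a * b) * (a * b) = (d%:R * a * b / n%:R) ^+ 2 * n%:R ^+ 2.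
    by field; rewrite gt_eqF.
  have -> : (lambda * n%:R) ^+ 2 * (a * b) = lambda ^+ 2 * a * b * n%:R ^+ 2 by ring.
  by rewrite ler_pM2r // exprn_gt0.
have : (lambda * n%:R) ^+ 2 < (d%:R * m%:R) ^+ 2.
  by rewrite ltr_pXn2r ?nnegrE ?mulr_ge0 ?ler0n ?(ltW l_gt0).
apply/negP; rewrite -leNgt; apply: le_trans bound'; rewrite exprMn ler_wpM2l ?exprn_ge0 //.
by rewrite expr2 ler_pM // ltW.
Qed.

(** If [Y], the neighbourhood of [A] in [Z], had fewer than [D * #|A|] elements, it would still
    receive at least [t * #|A|] edges from [A], twice the main term of the mixing lemma or more.
    Mixing then gives [t^2 <= 4 D lambda^2], which contradicts [d <= 8 k t] and the lower bound on
    [d]. *)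
Lemma mixing_expansion (Z A : {set G}) t k D m :
    (0 < k)%N -> (0 < D)%N -> (d <= 8 * k * t)%N -> (32 * k * D * m <= n)%N ->
    (16 * k * D)%:R * lambda < d%:R ->
    (forall v, (t <= #|[set w | edge v w && (w \in Z)]|)%N) -> (#|A| <= m.*2)%N ->
  (D * #|A| <= #|nbhd (@edge G) A :&: Z|)%N.
Proof.
move=> k0 D0 dt mn ld degZ Am; rewrite leqNgt; apply/negP; set Y := _ :&: Z => ltY.
have eAY : (t * #|A| <= edges_between A Y)%N.
  rewrite mulnC -sum_nat_const; apply: leq_sum => x xA; apply: leq_trans (degZ x) _.
  rewrite -sum1_card big_mkcond [X in (_ <= X)%N]big_mkcond /=; apply: leq_sum => y _.
  rewrite inE; case: (boolP (edge x y)) => //= exy; case: (boolP (y \in Z)) => //= yZ.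
  by rewrite inE yZ andbT; case: nbhdP => // -[]; exists x.
have yn : (2 * (d * #|Y|) <= t * n)%N.
  have : (d * #|Y| <= 8 * k * t * (D * m.*2))%N.
    by apply: leq_mul dt _; apply: leq_trans (ltnW ltY) _; rewrite leq_mul2l Am orbT.
  have : (t * (32 * k * D * m) <= t * n)%N by rewrite leq_mul2l mn orbT.
  by rewrite -muln2; clear; lia.
have A0 : (0 < #|A|)%N by case: #|A| ltY => //; rewrite muln0.
have := mixing A Y.
set a := #|A|%:R; set y := #|Y|%:R; set E := (edges_between A Y)%:R; set N := n%:R => bound.
have a0 : 0 < a by rewrite ltr0n.
have N0 : 0 < N by rewrite ltr0n.
have yD : y <= D%:R * a by rewrite -natrM ler_nat ltnW.
have Et : t%:R * a <= E by rewrite -natrM ler_nat.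
have yN : 2 * (d%:R * y) <= t%:R * N by rewrite -!natrM ler_nat.
have q_le : d%:R * a * y / N <= t%:R * a / 2.
  rewrite ler_pdivrMr // -(ler_pM2l (ltr0n R 2)).
  have -> : 2 * (t%:R * a / 2 * N) = a * (t%:R * N) by field.
  have -> : 2 * (d%:R * a * y) = a * (2 * (d%:R * y)) by ring.
  by rewrite ler_pM2l.
have half0 : 0 <= t%:R * a / 2 by rewrite divr_ge0 ?mulr_ge0 ?ler0n.
have half1 : t%:R * a / 2 <= E - d%:R * a * y / N by lra.
have half : (t%:R * a / 2) ^+ 2 <= (E - d%:R * a * y / N) ^+ 2.
  by rewrite ler_pXn2r ?nnegrE // (le_trans half0).
have t2 : t%:R ^+ 2 <= 4 * D%:R * lambda ^+ 2.
  rewrite -(ler_pM2r (exprn_gt0 2 a0)).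
  have -> : t%:R ^+ 2 * a ^+ 2 = 4 * (t%:R * a / 2) ^+ 2 by field.
  have -> : 4 * D%:R * lambda ^+ 2 * a ^+ 2 = 4 * (lambda ^+ 2 * a * (D%:R * a)) by ring.
  rewrite ler_pM2l ?ltr0n //; apply: le_trans half (le_trans bound _).
  by rewrite ler_wpM2l // mulr_ge0 ?exprn_ge0 // ltW.
have dR : d%:R <= 8 * k%:R * t%:R :> R by rewrite -!natrM ler_nat.
have : d%:R ^+ 2 <= ((16 * k * D)%:R * lambda) ^+ 2.
  apply: (@le_trans _ _ ((8 * k%:R * t%:R) ^+ 2)).
    by rewrite ler_pXn2r ?nnegrE ?mulr_ge0 ?ler0n.
  rewrite exprMn; apply: le_trans (ler_wpM2l _ t2) _; first by rewrite exprn_ge0 ?mulr_ge0 ?ler0n.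
  have -> : (8 * k%:R) ^+ 2 * (4 * D%:R * lambda ^+ 2) =
      (16 * k%:R * lambda) ^+ 2 * D%:R :> R by ring.
  have -> : ((16 * k * D)%:R * lambda) ^+ 2 = (16 * k%:R * lambda) ^+ 2 * D%:R ^+ 2 :> R.
    by rewrite !natrM; ring.
  rewrite ler_wpM2l ?exprn_ge0 ?mulr_ge0 ?ler0n ?(ltW l_gt0) //.
  by rewrite expr2 ler_peMr ?ler0n // ler1n.
by apply/negP; rewrite -ltNge ltr_pXn2r ?nnegrE ?mulr_ge0 ?ler0n ?(ltW l_gt0).
Qed.
End Pseudorandom.

(** * Choice of the constants and conclusion *)

Lemma smallest_colour (V : finType) k (c : V -> 'I_k) : (0 < k)%N ->
  exists i, (k * #|[set v | c v == i]| <= #|V|)%N.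
Proof.
move=> k0; pose F i := #|[set v | c v == i]|.
case: (arg_minnP F (erefl : xpredT (Ordinal k0))) => i _ imin; exists i.
have -> : #|V| = (\sum_(j < k) F j)%N.
  rewrite -sum1_card (partition_big c xpredT) //=; apply: eq_bigr => j _.
  by rewrite sum1_card; apply: eq_card => v; rewrite inE.
have -> : (k * #|[set v | c v == i]|)%N = (\sum_(j < k) F i)%N.
  by rewrite sum_nat_const card_ord.
by apply: leq_sum => j _; apply: imin.
Qed.

(** [X] is a smallest class of a balanced colouring with [k] colours, and a second class provides
    the expansion outside [X]. The value of [k] makes [32 delta^4 M] at most the number of leaves,
    where [M = n / k] bounds [#|X|]; that of [K] gives [m = n / K] the size that [mixing_expansion]
    asks for. *)
Lemma ndlambda_contains_tree (R : realType) (Delta h d : nat) (lambda : R) (G T : sgraph)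
    (delta := Delta.+1) (k := (32 * delta ^ 4 * h)%N) (D := (delta + 8 * delta ^ 3)%N)
    (K := (32 * k * D)%N) :
    (0 < h)%N -> (4 * k * (64 * k ^ 3 + 12) + K <= d)%N ->
    ndlambda_graph #|G| d lambda G -> 0 < lambda -> K.*2.+1%:R * lambda <= d%:R ->
    is_tree T -> #|T| = #|G| -> (max_degree T <= Delta)%N -> (#|G| <= h * #|leaves T|)%N ->
  contains_copy G T.
Proof.
move=> h0 dbig ndl l0 ld treeT cTG degT leavesT; set n := #|G| in ndl cTG leavesT *.
have [_ reg _] := ndl.
have k_gt1 : (1 < k)%N.
  have : (0 < delta ^ 4 * h)%N by rewrite muln_gt0 expn_gt0 h0.
  by rewrite /k -mulnA; move: (_ * h)%N; clear; lia.
have k0 := ltnW k_gt1.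
have D0 : (0 < D)%N by rewrite /D addn_gt0.
have kK : (k <= K)%N by rewrite /K mulnAC; apply: leq_pmull; rewrite muln_gt0.
have K0 : (0 < K)%N by apply: leq_trans kK.
have n0 : (0 < n)%N by rewrite -cTG; case: (treeT) => -[].
have dn : (d <= n)%N.
  by have /card_gt0P[v _] := n0; rewrite -(reg v) max_card.
have d4k : (4 * k * (64 * k ^ 3 + 12) <= d)%N by apply: leq_trans dbig; apply: leq_addr.
have Kd : (K <= d)%N by apply: leq_trans dbig; apply: leq_addl.
have d0 : (0 < d)%N by apply: leq_trans Kd.
have ltd : lambda < d%:R.
  apply: lt_le_trans ld; rewrite -[X in X < _]mul1r ltr_pM2r // ltr1n.
  by move: K0; clear; lia.
have mix S S' := @expander_mixing R G d lambda S S' ndl (ltW l0) ltd n0.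
have [c cP] := balanced_colouring (@edge_sym G) d0 k0 reg (colouring_threshold k0 d4k).
have [i Xi] := smallest_colour c k0; pose X := [set v | c v == i].
have [i' ii'] : exists i', i' != i.
  pose o0 := Ordinal k0; pose o1 := Ordinal k_gt1.
  by case: (eqVneq i o0) => [->|]; [exists o1|exists o0; rewrite eq_sym].
pose m := (n %/ K)%N; pose M := (n %/ k)%N.
have mM : (m <= M)%N by apply: leq_div2l.
have m0 : (0 < m)%N by rewrite divn_gt0 // (leq_trans Kd).
have XM : (#|X| <= M)%N by rewrite leq_divRL // mulnC.
(* Rounding down costs at most a factor two since [m] is positive; hence the constant [K.*2.+1] in
   the bound on [d]. *)
have n_lt : (n <= K.*2 * m)%N.
  have : (n < m.+1 * K)%N by apply: ltn_ceil.
  by rewrite mulSn -muln2; move: m0; clear; nia.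
have jG : joined (@edge G) m.
  apply: (mixing_joined l0 n0 mix m0).
  apply: (@lt_le_trans _ _ (K.*2.+1%:R * lambda * m%:R)); last by rewrite ler_wpM2r.
  rewrite mulrAC mulrC ltr_pM2r // -natrM ltr_nat.
  by apply: leq_ltn_trans n_lt _; rewrite mulSn -[X in (X < _)%N]add0n ltn_add2r.
pose t := (d %/ (4 * k))%N.
have k4 : (0 < 4 * k)%N by rewrite muln_gt0.
have dt : (d <= 8 * k * t)%N.
  have t0 : (0 < t)%N.
    rewrite divn_gt0 //; apply: leq_trans d4k; apply: leq_pmulr.
    by rewrite addn_gt0 orbT.
  have : (d < t.+1 * (4 * k))%N by apply: ltn_ceil.
  by rewrite mulSn; move: t0 k0; clear; nia.
have mn : (32 * k * D * m <= n)%N by rewrite mulnC leq_trunc_div.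
have ld16 : (16 * k * D)%:R * lambda < d%:R.
  apply: lt_le_trans ld; rewrite ltr_pM2r // ltr_nat ltnS -muln2 /K.
  by clear; lia.
have expand j (A : {set G}) : (#|A| <= m.*2)%N ->
    (D * #|A| <= #|nbhd (@edge G) A :&: [set v | c v == j]|)%N.
  apply: (mixing_expansion l0 n0 mix k0 D0 dt mn ld16) => v.
  apply: leq_trans (cP v j) _; apply/subset_leq_card/subsetP => w.
  by rewrite !inE.
have ext0 : extendable (@edge G) X m D (fun=> None).
  apply/forallP => A; apply/implyP => /(expand i')/leq_trans; apply.
  apply/subset_leq_card/subsetP => y /setIP[/nbhdP[x xA exy]]; rewrite inE => /eqP cy.
  by apply/nbhdP; exists x; rewrite // /avail exy inE cy ii'.
have expX (A : {set G}) : (#|A| <= m)%N -> (#|A| <= #|nbhd (@edge G) A :&: X|)%N.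
  move=> Am; apply: leq_trans (expand i A _); first exact: leq_pmull.
  by apply: leq_trans Am _; rewrite -addnn leq_addr.
have T2 : (2 < #|T|)%N.
  rewrite cTG; apply: leq_trans dn; apply: leq_trans Kd; rewrite /K -mulnA.
  by apply: (@leq_trans 32) => //; apply: leq_pmulr; rewrite muln_gt0 k0.
apply: (tree_copy jG m0 mM XM ext0 expX treeT) => //.
rewrite -(leq_pmul2l h0); apply: leq_trans leavesT.
by rewrite mulnCA mulnA -/k mulnC leq_trunc_div.
Qed.

Theorem theorem1p6 (R : realType) (Delta : nat) (alpha : R)
    (alpha_gt0 : 0 < alpha) :
  exists2 C : R, 0 < C &
    exists d0 : nat, forall d : nat, (d0 <= d)%N ->
      forall (n : nat) (lambda : R) (G : sgraph),
        ndlambda_graph n d lambda G ->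
        C <= d%:R / lambda ->
        forall T : sgraph,
          is_tree T ->
          #|T| = n ->
          (max_degree T <= Delta)%N ->
          alpha * n%:R <= #|leaves T|%:R ->
          contains_copy G T.
Proof.
(* An integer above [1 / alpha], so that there are at least [n / h] leaves. *)
pose h := (Num.bound alpha^-1).+1.
pose k := (32 * Delta.+1 ^ 4 * h)%N.
pose K := (32 * k * (Delta.+1 + 8 * Delta.+1 ^ 3))%N.
exists K.*2.+1%:R; first by rewrite ltr0n.
exists (4 * k * (64 * k ^ 3 + 12) + K)%N => d dbig n lambda G ndl ratio T treeT cT degT leafT.
have [cG _ _] := ndl; rewrite -cG in ndl cT leafT.
(* For [lambda <= 0] the quotient [d / lambda] is at most zero, division by zero being zero, so the
   lower bound on the ratio forces [lambda] to be positive. *)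
have l0 : 0 < lambda.
  rewrite ltNge; apply/negP => l_le0; have : d%:R / lambda <= 0.
    by rewrite mulr_ge0_le0 ?ler0n // invr_le0.
  by apply/negP; rewrite -ltNge; apply: lt_le_trans ratio; rewrite ltr0n.
apply: (@ndlambda_contains_tree R Delta h d lambda G T) => //.
  by rewrite -ler_pdivlMr.
rewrite -(ler_nat R) natrM; apply: (@le_trans _ _ (alpha^-1 * #|leaves T|%:R)).
  by rewrite mulrC ler_pdivlMr // mulrC.
rewrite ler_wpM2r ?ler0n // ltW // -natr1.
apply: lt_trans (archi_boundP _) _; first by rewrite invr_ge0 ltW.
by rewrite ltrDl.
Qed.
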